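(* Let $\tau\in\mathbb{H}$ and put $b=r^5(\tau)$, where $r$ is the Rogers–Ramanujan continued fraction. Then $$X=\frac{-\varepsilon}{\sqrt{5}}\ \frac{r^4(5\tau)-3r^3(5\tau)+4r^2(5\tau)-2r(5\tau)+1}{r^2(5\tau)+r(5\tau)+\varepsilon^2}$$ is the $X$-coordinate of a point $P=(X,Y)$ of order $5$ on the elliptic curve $E_5(b)$ which is not in the group $\langle(0,0)\rangle$. The $Y$-coordinates of $P$ and $-P$ are products of linear fractional expressions in $r(5\tau)$ with coefficients in $\mathbb{Q}(\zeta_5)$; and the same holds for the coordinates of all points in $E_5(b)[5]-\langle(0,0)\rangle$.
   Context: $\mathbb{H}$ is the complex upper half-plane. The Rogers–Ramanujan continued fraction is the function on $\mathbb{H}$ given by $r(\tau)=q^{1/5}\prod_{n\ge1}(1-q^n)^{(n/5)}$, where $q=e^{2\pi i\tau}$, $q^{1/5}=e^{2\pi i\tau/5}$, and $(n/5)$ is the Legendre symbol (equivalently $r(\tau)=\frac{q^{1/5}}{1+}\frac{q}{1+}\frac{q^2}{1+}\cdots$). For a parameter $b$, $E_5(b)$ denotes the Tate normal form $Y^2+(1+b)XY+bY=X^3+bX^2$, on which $(0,0)$ is a point of order $5$, and $\langle(0,0)\rangle=\{O,(0,0),(0,-b),(-b,0),(-b,b^2)\}$. $\varepsilon=\frac{-1+\sqrt5}{2}$, and $\zeta_5$ is a primitive fifth root of unity. *)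

(* Defs.v *)
From Stdlib Require Import Reals ZArith List.
From Coquelicot Require Import Coquelicot.

Open Scope C_scope.

Definition Cexp (z : C) : C :=
  RtoC (exp (Re z)) * (cos (Im z), sin (Im z)).

Definition Cpowz (z : C) (k : Z) : C :=
  match k with
  | Z0 => 1
  | Zpos p => z ^ Pos.to_nat p
  | Zneg p => / z ^ Pos.to_nat p
  end.

(** The Legendre symbol (n/p); meaningful for [p] an odd prime. *)
Definition legendre (n p : nat) : Z :=
  if Nat.eqb (n mod p) 0 then 0%Z
  else if existsb (fun x => Nat.eqb ((x * x) mod p) (n mod p)) (seq 1 (p - 1))
       then 1%Z else (-1)%Z.

(** [Lim_seq] is total, with an unspecified meaning on divergent sequences;
    on a convergent sequence of complex numbers [Clim] is its limit. *)
Definition Clim (u : nat -> C) : C :=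
  (real (Lim_seq (fun n => Re (u n))), real (Lim_seq (fun n => Im (u n)))).

(** f(1) f(2) ... f(N) *)
Definition Cprod (f : nat -> C) (N : nat) : C :=
  fold_right Cmult 1 (map f (seq 1 N)).

Definition rr (tau : C) : C :=
  let q := Cexp (2 * PI * Ci * tau) in
  Cexp (2 * PI * Ci * tau / 5)
  * Clim (Cprod (fun n => Cpowz (1 - q ^ n) (legendre n 5))).

(** y^2 + a1 x y + a3 y = x^3 + a2 x^2 + a4 x + a6 *)
Record weierstrass := Weierstrass { a1 : C; a2 : C; a3 : C; a4 : C; a6 : C }.

Definition discriminant (E : weierstrass) : C :=
  let b2 := a1 E ^ 2 + 4 * a2 E in
  let b4 := 2 * a4 E + a1 E * a3 E in
  let b6 := a3 E ^ 2 + 4 * a6 E in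
  let b8 := a1 E ^ 2 * a6 E + 4 * a2 E * a6 E - a1 E * a3 E * a4 E
            + a2 E * a3 E ^ 2 - a4 E ^ 2 in
  - b2 ^ 2 * b8 - 8 * b4 ^ 3 - 27 * b6 ^ 2 + 9 * b2 * b4 * b6.

Definition is_elliptic (E : weierstrass) : Prop := discriminant E <> 0.

Inductive point := Infinity | Affine (x y : C).

Definition on_curve (E : weierstrass) (P : point) : Prop :=
  match P with
  | Infinity => True
  | Affine x y =>
      y ^ 2 + a1 E * x * y + a3 E * y = x ^ 3 + a2 E * x ^ 2 + a4 E * x + a6 E
  end.

Definition opp_pt (E : weierstrass) (P : point) : point :=
  match P with
  | Infinity => Infinity
  | Affine x y => Affine x (- y - a1 E * x - a3 E)
  end.

(** The third intersection point of the line of slope [l] through (x1,y1) and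
    a point with abscissa [x2], reflected by [opp_pt]. *)
Definition chord_pt (E : weierstrass) (l x1 y1 x2 : C) : point :=
  let x3 := l ^ 2 + a1 E * l - a2 E - x1 - x2 in
  opp_pt E (Affine x3 (l * (x3 - x1) + y1)).

Definition add_pt (E : weierstrass) (P Q : point) : point :=
  match P, Q with
  | Infinity, _ => Q
  | _, Infinity => P
  | Affine x1 y1, Affine x2 y2 =>
      if Ceq_dec x1 x2 then
        if Ceq_dec (y1 + y2 + a1 E * x2 + a3 E) 0 then Infinity
        else chord_pt E ((3 * x1 ^ 2 + 2 * a2 E * x1 + a4 E - a1 E * y1)
                         / (2 * y1 + a1 E * x1 + a3 E)) x1 y1 x2
      else chord_pt E ((y2 - y1) / (x2 - x1)) x1 y1 x2
  end.

Fixpoint mul_pt (E : weierstrass) (n : nat) (P : point) : point :=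
  match n with
  | O => Infinity
  | S m => add_pt E P (mul_pt E m P)
  end.

Definition zmul_pt (E : weierstrass) (k : Z) (P : point) : point :=
  if (k <? 0)%Z then opp_pt E (mul_pt E (Z.abs_nat k) P)
  else mul_pt E (Z.abs_nat k) P.

Definition has_order (E : weierstrass) (P : point) (n : nat) : Prop :=
  (0 < n)%nat /\ mul_pt E n P = Infinity /\
  forall m : nat, (0 < m < n)%nat -> mul_pt E m P <> Infinity.

Definition torsion (E : weierstrass) (n : nat) (P : point) : Prop :=
  on_curve E P /\ mul_pt E n P = Infinity.

Definition generated (E : weierstrass) (P Q : point) : Prop :=
  exists k : Z, Q = zmul_pt E k P.

(** The Tate normal form Y^2 + (1+b) X Y + b Y = X^3 + b X^2. *)
Definition E5 (b : C) : weierstrass := Weierstrass (1 + b) b b 0 0.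

Definition primitive_root (n : nat) (z : C) : Prop :=
  (0 < n)%nat /\ z ^ n = 1 /\ forall m : nat, (0 < m < n)%nat -> z ^ m <> 1.

Record subfield (K : C -> Prop) : Prop := {
  subfield_1 : K 1;
  subfield_sub : forall x y, K x -> K y -> K (x - y);
  subfield_mul : forall x y, K x -> K y -> K (x * y);
  subfield_inv : forall x, K x -> x <> 0 -> K (/ x) }.

(** Q(z), the smallest subfield of C containing [z]. *)
Definition Qadjoin (z x : C) : Prop :=
  forall K : C -> Prop, subfield K -> K z -> K x.

(** The formal expression (lf_a T + lf_b) / (lf_c T + lf_d). *)
Record linfrac := LinFrac { lf_a : C; lf_b : C; lf_c : C; lf_d : C }.

Definition linfrac_over (K : C -> Prop) (f : linfrac) : Prop :=
  K (lf_a f) /\ K (lf_b f) /\ K (lf_c f) /\ K (lf_d f) /\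
  lf_a f * lf_d f - lf_b f * lf_c f <> 0.

Definition linfrac_eval (t : C) (f : linfrac) : C :=
  (lf_a f * t + lf_b f) / (lf_c f * t + lf_d f).

(** The product of the expressions in [L] is defined at [t], with value [v]. *)
Definition linfrac_prod (L : list linfrac) (t v : C) : Prop :=
  List.Forall (fun f => lf_c f * t + lf_d f <> 0) L /\
  v = fold_right Cmult 1 (map (linfrac_eval t) L).

Definition eps : C := (-1 + sqrt 5) / 2.

Definition X_den (t : C) : C := t ^ 2 + t + eps ^ 2.

Definition X_coord (t : C) : C :=
  - eps / sqrt 5 * ((t ^ 4 - 3 * t ^ 3 + 4 * t ^ 2 - 2 * t + 1) / X_den t).

(* Main.v *)
Require Import Defs.
From Stdlib Require Import Reals ZArith List Lra Lia.
From Coquelicot Require Import Coquelicot.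
Open Scope C_scope.

(** Write q = e^(2 pi i tau), u = r(tau), t = r(5 tau), and let z run over the
    primitive fifth roots of unity.  Splitting the theta series of z and q
    according to exponents mod 5, the Jacobi triple product gives
      (q, zq, q/z; q)_oo = alpha + (z^2 + z^3) gamma   with gamma/alpha = t,
    where q -> z^k q fixes alpha and multiplies gamma by z^k.  Hence the twelve
    linear forms alpha, gamma, alpha + (z^2 + z^3) z^k gamma have product
    expansions and do not vanish.  The quartics t^4 - 3t^3 + 4t^2 - 2t + 1 and
    t^4 + 2t^3 + 4t^2 + 3t + 1 are products of four of these forms, and comparing
    factors yields b = u^5 = t (t^4 - 3t^3 + 4t^2 - 2t + 1)/(t^4 + 2t^3 + 4t^2 + 3t + 1).

    Over this parametrization the 5-division polynomial of E_5(b) splits: it is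
    5 x (x + b) times two conjugate quintics over Q(sqrt 5)(b), whose roots are the
    values of x_param w at t and at its images under the five Moebius
    transformations preserving b.  All coordinates have their zeros and poles at
    the twelve cusps of t, hence are products of linear fractional expressions. *)

(** * Limits and infinite products *)

(** The lists of linear fractional expressions are chosen before tau, so they depend on zeta alone
    and tau enters only through t. Limits, inverses and quotients are total functions, so each use
    has to be backed by convergence or by a nonvanishing proof valid at every tau. The nonvanishing
    traces back to one fact: a product that converges along with the product of the inverses of its
    factors has a nonzero limit. The relation between b and t needs no function theory beyond this:
    arranged suitably, the n-th factors of its two sides agree, and as z^n depends only on n modulo
    5, there are five cases to check. From there on everything is algebra over Q(zeta_5). Order 5 is
    treated by chords and tangents, through the criterion that 2P and 3P share their abscissa,
    worked out directly from [add_pt]. *)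

Definition limC (u : nat -> C) (l : C) : Prop :=
  is_lim_seq (fun n => Cmod (u n - l)) 0.

Lemma limC_bound (u : nat -> C) (l : C) (v : nat -> R) :
  (forall n, Cmod (u n - l) <= v n)%R -> is_lim_seq v 0 -> limC u l.
Proof.
  intros H Hv. apply is_lim_seq_le_le with (2 := is_lim_seq_const 0) (3 := Hv).
  intros n; split; [apply Cmod_ge_0 | apply H].
Qed.

Lemma limC_ext_loc (u v : nat -> C) (l : C) :
  eventually (fun n => u n = v n) -> limC u l -> limC v l.
Proof.
  intros H. apply is_lim_seq_ext_loc.
  destruct H as [N H]. exists N. intros n Hn. now rewrite H.
Qed.

Lemma limC_ext (u v : nat -> C) (l : C) :
  (forall n, u n = v n) -> limC u l -> limC v l.
Proof. intros H. apply limC_ext_loc. exists O. auto. Qed.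

Lemma limC_const (c : C) : limC (fun _ => c) c.
Proof.
  apply is_lim_seq_ext with (fun _ => 0%R); [|apply is_lim_seq_const].
  intros _. replace (c - c) with (RtoC 0) by ring. now rewrite Cmod_0.
Qed.

Lemma limC_plus (u v : nat -> C) (l m : C) :
  limC u l -> limC v m -> limC (fun n => u n + v n) (l + m).
Proof.
  intros Hu Hv. eapply limC_bound.
  2:{ replace (Finite 0) with (Finite (0 + 0)) by (f_equal; ring).
      exact (is_lim_seq_plus' _ _ _ _ Hu Hv). }
  intros n; simpl. replace (u n + v n - (l + m)) with ((u n - l) + (v n - m)) by ring.
  apply Cmod_triangle.
Qed.

Lemma limC_mult (u v : nat -> C) (l m : C) :
  limC u l -> limC v m -> limC (fun n => u n * v n) (l * m).
Proof.
  intros Hu Hv.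
  apply limC_bound with (fun n => Cmod (u n - l) * Cmod (v n - m)
    + (Cmod (u n - l) * Cmod m + Cmod l * Cmod (v n - m)))%R.
  - intros n.
    replace (u n * v n - l * m) with
      ((u n - l) * (v n - m) + ((u n - l) * m + l * (v n - m))) by ring.
    eapply Rle_trans; [apply Cmod_triangle|]. rewrite Cmod_mult.
    apply Rplus_le_compat_l.
    eapply Rle_trans; [apply Cmod_triangle|]. rewrite !Cmod_mult. lra.
  - replace (Finite 0) with (Finite (0 * 0 + (0 * Cmod m + Cmod l * 0))%R)
      by (f_equal; ring).
    apply is_lim_seq_plus'; [|apply is_lim_seq_plus'];
      apply is_lim_seq_mult'; auto using is_lim_seq_const.
Qed.

Lemma limC_scal (c : C) (u : nat -> C) (l : C) :
  limC u l -> limC (fun n => c * u n) (c * l).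
Proof. intros H. apply limC_mult; [apply limC_const | exact H]. Qed.

Lemma limC_comp (phi : nat -> nat) (u : nat -> C) (l : C) :
  filterlim phi eventually eventually -> limC u l -> limC (fun n => u (phi n)) l.
Proof.
  intros Hp Hu. unfold limC.
  exact (is_lim_seq_subseq (fun n => Cmod (u n - l)) _ phi Hp Hu).
Qed.

Lemma filterlim_eventually_ge (phi : nat -> nat) (k : nat) :
  (forall n, n <= phi n + k)%nat -> filterlim phi eventually eventually.
Proof.
  intros H P [N HN]. exists (N + k)%nat. intros n Hn. apply HN.
  specialize (H n). lia.
Qed.

Lemma limC_unique (u : nat -> C) (l m : C) : limC u l -> limC u m -> l = m.
Proof.
  intros Hl Hm.
  assert (H : is_lim_seq (fun n => Cmod (u n - l) + Cmod (u n - m))%R (Finite (0 + 0)%R))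
    by (apply is_lim_seq_plus'; assumption).
  assert (Hle : Rbar_le (Finite (Cmod (l - m))) (Finite (0 + 0)%R)).
  { apply is_lim_seq_le with (2 := is_lim_seq_const (Cmod (l - m))) (3 := H).
    intros n. replace (l - m) with (- (u n - l) + (u n - m)) by ring.
    eapply Rle_trans; [apply Cmod_triangle|]. rewrite Cmod_opp. lra. }
  simpl in Hle. assert (H0 : Cmod (l - m) = 0%R) by (pose proof (Cmod_ge_0 (l - m)); lra).
  apply Cmod_eq_0 in H0. replace l with (l - m + m) by ring. rewrite H0. ring.
Qed.

Lemma im_le_Cmod (c : C) : (Rabs (Im c) <= Cmod c)%R.
Proof.
  eapply Rle_trans; [|apply Rmax_Cmod]. destruct c; simpl. apply Rmax_r.
Qed.

Lemma limC_Re_Im (u : nat -> C) (l : C) :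
  limC u l -> is_lim_seq (fun n => Re (u n)) (Re l) /\ is_lim_seq (fun n => Im (u n)) (Im l).
Proof.
  intros H.
  assert (G : forall (p : C -> R), (forall x y : C, p (x - y)%C = (p x - p y)%R) ->
    (forall x : C, Rabs (p x) <= Cmod x)%R -> is_lim_seq (fun n => p (u n)) (p l)).
  { intros p Hp Hb.
    assert (H1 : is_lim_seq (fun n => p (u n) - p l)%R 0).
    { apply is_lim_seq_abs_0.
      apply is_lim_seq_le_le with (2 := is_lim_seq_const 0) (3 := H).
      intros n; split; [apply Rabs_pos|]. rewrite <- Hp. apply Hb. }
    apply is_lim_seq_ext with (fun n => (p (u n) - p l) + p l)%R; [intros; ring|].
    replace (Finite (p l)) with (Finite (0 + p l)%R) by (f_equal; ring).
    apply is_lim_seq_plus'; [exact H1 | apply is_lim_seq_const]. }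
  split; apply G; auto using re_le_Cmod, im_le_Cmod;
    intros [x1 x2] [y1 y2]; simpl; ring.
Qed.

Lemma limC_of_Re_Im (u : nat -> C) (a b : R) :
  is_lim_seq (fun n => Re (u n)) a -> is_lim_seq (fun n => Im (u n)) b ->
  limC u (a, b).
Proof.
  intros Ha Hb.
  apply limC_bound with (fun n => Rabs (Re (u n) - a) + Rabs (Im (u n) - b))%R.
  - intros n. destruct (u n) as [x y]; simpl.
    replace ((x, y) - (a, b)) with (RtoC (x - a)%R + Ci * RtoC (y - b)%R)
      by (unfold Cminus, Cplus, Copp, Cmult, Ci, RtoC; simpl; f_equal; ring).
    eapply Rle_trans; [apply Cmod_triangle|].
    rewrite Cmod_mult, Cmod_Ci, !Cmod_R. lra.
  - replace (Finite 0) with (Finite (Rabs (a - a) + Rabs (b - b))%R)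
      by (f_equal; rewrite !Rminus_diag, Rabs_R0; ring).
    apply is_lim_seq_plus'; refine (is_lim_seq_abs _ (Finite _) _);
      apply is_lim_seq_minus'; auto using is_lim_seq_const.
Qed.

(** The bridge to [rr]: the values returned by [Lim_seq] are meaningful once convergence is proved,
    so every product below is shown to converge before it is evaluated. *)
Lemma Clim_limC (u : nat -> C) (l : C) : limC u l -> Clim u = l.
Proof.
  intros H. apply limC_Re_Im in H as [H1 H2]. unfold Clim.
  rewrite (is_lim_seq_unique _ _ H1), (is_lim_seq_unique _ _ H2).
  now destruct l.
Qed.

Lemma limC_inv (u : nat -> C) (l : C) :
  l <> 0 -> limC u l -> limC (fun n => / u n) (/ l).
Proof.
  intros Hl Hu.
  assert (Hlp : (0 < Cmod l)%R) by now apply Cmod_gt_0.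
  assert (Hev : eventually (fun n => Cmod (u n - l) < Cmod l / 2)%R).
  { apply is_lim_seq_spec in Hu.
    assert (Hp : (0 < Cmod l / 2)%R) by lra.
    destruct (Hu (mkposreal _ Hp)) as [N HN]. exists N. intros n Hn.
    specialize (HN n Hn). simpl in HN. rewrite Rminus_0_r in HN.
    rewrite Rabs_right in HN; [exact HN|]. apply Rle_ge, Cmod_ge_0. }
  apply is_lim_seq_le_le_loc with (u := fun _ => 0%R)
    (w := fun n => (2 / (Cmod l * Cmod l) * Cmod (u n - l))%R).
  - destruct Hev as [N HN]. exists N. intros n Hn. specialize (HN n Hn).
    split; [apply Cmod_ge_0|].
    assert (Hun : (Cmod l / 2 <= Cmod (u n))%R).
    { assert (Cmod l <= Cmod (u n) + Cmod (u n - l))%R; [|lra].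
      replace l with (u n + - (u n - l)) at 1 by ring.
      eapply Rle_trans; [apply Cmod_triangle|]. rewrite Cmod_opp. lra. }
    assert (u n <> 0) by (apply Cmod_gt_0; lra).
    replace (/ u n - / l) with (- (u n - l) / (u n * l)) by (field; auto).
    rewrite Cmod_div by (apply Cmult_neq_0; auto).
    rewrite Cmod_opp, Cmod_mult.
    unfold Rdiv. rewrite (Rmult_comm (Cmod _)).
    apply Rmult_le_compat_r; [apply Cmod_ge_0|].
    replace (2 * / (Cmod l * Cmod l))%R with (/ (Cmod l / 2 * Cmod l))%R
      by (field; lra).
    apply Rinv_le_contravar; [apply Rmult_lt_0_compat; lra|].
    apply Rmult_le_compat_r; lra.
  - apply is_lim_seq_const.
  - replace (Finite 0) with (Finite (2 / (Cmod l * Cmod l) * 0)%R) by (f_equal; ring).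
    apply is_lim_seq_mult'; [apply is_lim_seq_const | exact Hu].
Qed.

Lemma limC_bounded (u : nat -> C) (l : C) :
  limC u l -> exists K, (0 <= K)%R /\ forall n, (Cmod (u n) <= K)%R.
Proof.
  intros H.
  assert (Hb : exists K, forall n, (Cmod (u n - l) <= K)%R).
  { apply is_lim_seq_spec in H. destruct (H (mkposreal 1 Rlt_0_1)) as [N HN].
    simpl in HN.
    assert (G : forall m, exists K, forall n, (n < m)%nat -> (Cmod (u n - l) <= K)%R).
    { induction m as [|m [K HK]]; [exists 0%R; lia|].
      exists (Rmax K (Cmod (u m - l))). intros n Hn.
      destruct (Nat.eq_dec n m) as [->|]; [apply Rmax_r|].
      eapply Rle_trans; [apply HK; lia | apply Rmax_l]. }
    destruct (G N) as [K HK]. exists (Rmax K 1). intros n.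
    destruct (le_lt_dec N n) as [Hn|Hn].
    - eapply Rle_trans; [|apply Rmax_r]. specialize (HN n Hn).
      rewrite Rminus_0_r in HN. pose proof (Rle_abs (Cmod (u n - l))). lra.
    - eapply Rle_trans; [apply HK, Hn | apply Rmax_l]. }
  destruct Hb as [K HK]. exists (K + Cmod l)%R. split.
  - pose proof (HK O). pose proof (Cmod_ge_0 (u O - l)). pose proof (Cmod_ge_0 l). lra.
  - intros n. replace (u n) with ((u n - l) + l) by ring.
    eapply Rle_trans; [apply Cmod_triangle|]. specialize (HK n). lra.
Qed.

(** * Convergence of infinite products *)

(** Grows at the upper end, so that one more factor is a definitional step; the [fold_right] in
    [Cprod] peels off the lower end instead. *)
Fixpoint cprod (f : nat -> C) (n : nat) : C :=
  match n with O => 1 | S m => cprod f m * f m end.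

Lemma Cprod_cprod (f : nat -> C) (N : nat) : Cprod f N = cprod (fun i => f (S i)) N.
Proof.
  induction N as [|N IH]; [reflexivity|].
  cbn [cprod]. rewrite <- IH. unfold Cprod. rewrite seq_S, map_app, fold_right_app.
  change (1 + N)%nat with (S N). cbn [map fold_right]. rewrite Cmult_1_r.
  generalize (f (S N)) (map f (seq 1 N)). intros c s.
  induction s as [|a s IHs]; simpl; [|rewrite IHs]; ring.
Qed.

Lemma cprod_ext (f g : nat -> C) (n : nat) :
  (forall i, (i < n)%nat -> f i = g i) -> cprod f n = cprod g n.
Proof.
  induction n as [|n IH]; intros H; [reflexivity|]. simpl.
  rewrite IH, H; auto.
Qed.

Lemma cprod_mult (f g : nat -> C) (n : nat) :
  cprod (fun i => f i * g i) n = cprod f n * cprod g n.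
Proof. induction n as [|n IH]; simpl; [ring|]. rewrite IH. ring. Qed.

Lemma cprod_add (f : nat -> C) (m n : nat) :
  cprod f (m + n) = cprod f m * cprod (fun i => f (m + i)%nat) n.
Proof.
  induction n as [|n IH]; simpl; [rewrite Nat.add_0_r; ring|].
  rewrite Nat.add_succ_r. simpl. rewrite IH. ring.
Qed.

Lemma cprod_S_l (f : nat -> C) (n : nat) :
  cprod f (S n) = f O * cprod (fun i => f (S i)) n.
Proof. change (S n) with (1 + n)%nat. rewrite cprod_add. simpl. ring. Qed.

Lemma cprod_neq_0 (f : nat -> C) (n : nat) :
  (forall i, f i <> 0) -> cprod f n <> 0.
Proof.
  intros H. induction n as [|n IH]; simpl; [apply C1_nz|].
  now apply Cmult_neq_0.
Qed.

Lemma cprod_inv (f : nat -> C) (n : nat) :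
  (forall i, f i <> 0) -> cprod (fun i => / f i) n = / cprod f n.
Proof.
  intros H. induction n as [|n IH]; simpl; [field; apply C1_nz|].
  rewrite IH. field. split; auto using cprod_neq_0.
Qed.

(** Unlike in the classical notion of a convergent product, the limit may be 0; nonvanishing is
    always stated separately. *)
Definition prodlim (f : nat -> C) (l : C) : Prop := limC (cprod f) l.

Lemma prodlim_ext (f g : nat -> C) (l : C) :
  (forall i, f i = g i) -> prodlim f l -> prodlim g l.
Proof. intros H. apply limC_ext. intros n. apply cprod_ext. auto. Qed.

Lemma prodlim_mult (f g : nat -> C) (l m : C) :
  prodlim f l -> prodlim g m -> prodlim (fun i => f i * g i) (l * m).
Proof.
  intros Hf Hg. apply limC_ext with (fun n => cprod f n * cprod g n).
  - intros n. now rewrite cprod_mult.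
  - now apply limC_mult.
Qed.

Lemma prodlim_pow (f : nat -> C) (l : C) (k : nat) :
  prodlim f l -> prodlim (fun i => f i ^ k) (l ^ k).
Proof.
  intros H. induction k as [|k IH]; simpl.
  - apply limC_ext with (fun _ => RtoC 1); [|apply limC_const].
    intros n. induction n as [|n IHn]; simpl; [reflexivity|]. rewrite <- IHn. ring.
  - now apply prodlim_mult.
Qed.

(* The partial products are bounded by [exp (sum |f i - 1|)], so consecutive
   differences are summable. *)
Lemma prodlim_ex (f : nat -> C) :
  ex_series (fun i => Cmod (f i - 1)) -> exists l, prodlim f l.
Proof.
  intros [s Hs].
  assert (Hle : forall n, (Cmod (cprod f n) <= exp s)%R).
  { assert (H : forall n, (Cmod (cprod f (S n)) <= exp (sum_n (fun i => Cmod (f i - 1)) n))%R).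
    { assert (H1 : forall n, (Cmod (f n) <= exp (Cmod (f n - 1)))%R).
      { intros n. replace (f n) with (1 + (f n - 1)) at 1 by ring.
        eapply Rle_trans; [apply Cmod_triangle|]. rewrite Cmod_1. apply exp_ineq1_le. }
      induction n as [|n IH].
      - simpl. rewrite sum_O, Cmult_1_l. apply H1.
      - rewrite sum_Sn. change (cprod f (S (S n))) with (cprod f (S n) * f (S n)).
        rewrite Cmod_mult. unfold plus; simpl. rewrite exp_plus.
        apply Rmult_le_compat; auto using Cmod_ge_0. }
    assert (Hsn : forall n, (sum_n (fun i => Cmod (f i - 1)) n <= s)%R).
    { intros n. apply is_lim_seq_incr_compare with (1 := Hs).
      intros m. rewrite sum_Sn. unfold plus; simpl.
      pose proof (Cmod_ge_0 (f (S m) - 1)). lra. }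
    intros [|n].
    - simpl. rewrite Cmod_1. eapply Rle_trans; [|apply exp_ineq1_le].
      pose proof (Hsn O) as H0. rewrite sum_O in H0.
      pose proof (Cmod_ge_0 (f O - 1)). lra.
    - eapply Rle_trans; [apply H|]. destruct (Hsn n) as [Hlt|Heq].
      + left. now apply exp_increasing.
      + rewrite Heq. apply Rle_refl. }
  (* For p = [Re] or [Im] the partial products are the telescoping sums of an absolutely convergent
     real series. *)
  assert (G : forall (p : C -> R), (forall x y : C, p (x - y)%C = (p x - p y)%R) ->
    (forall x : C, Rabs (p x) <= Cmod x)%R -> exists a : R, is_lim_seq (fun n => p (cprod f n)) a).
  { intros p Hp Hb.
    assert (He : ex_series (fun n => p (cprod f (S n)) - p (cprod f n))%R).
    { apply (ex_series_le (K := R_AbsRing) (V := R_CompleteNormedModule)) with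
        (b := (fun n => exp s * Cmod (f n - 1))%R).
      - intros n. change norm with Rabs. rewrite <- Hp.
        eapply Rle_trans; [apply Hb|]. simpl.
        replace (cprod f n * f n - cprod f n) with (cprod f n * (f n - 1)) by ring.
        rewrite Cmod_mult. apply Rmult_le_compat_r; [apply Cmod_ge_0 | apply Hle].
      - apply @ex_series_scal_l. now exists s. }
    destruct He as [a Ha]. exists (a + p 1)%R.
    apply is_lim_seq_incr_1.
    apply is_lim_seq_ext with
      (fun n => sum_n (fun n => p (cprod f (S n)) - p (cprod f n))%R n + p 1)%R.
    - intros n. induction n as [|n IH].
      + rewrite sum_O. simpl. ring.
      + rewrite sum_Sn. unfold plus at 1; simpl AbelianMonoid.plus.
        transitivity ((sum_n (fun n => p (cprod f (S n)) - p (cprod f n))%R n + p 1)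
          + (p (cprod f (S (S n))) - p (cprod f (S n))))%R; [simpl; ring|].
        rewrite IH. ring.
    - apply is_lim_seq_plus'; [exact Ha | apply is_lim_seq_const]. }
  destruct (G Re) as [a Ha]; [intros [? ?] [? ?]; reflexivity | apply re_le_Cmod |].
  destruct (G Im) as [b Hb]; [intros [? ?] [? ?]; reflexivity | apply im_le_Cmod |].
  exists (a, b). now apply limC_of_Re_Im.
Qed.

(** The limit is nonzero because the product of the inverses converges too, and the two limits
    multiply to 1. *)
Lemma prodlim_geom (f : nat -> C) (K r : R) :
  (0 <= r < 1)%R -> (forall i, Cmod (f i - 1) <= K * r ^ i)%R -> (forall i, f i <> 0) ->
  exists l : C, l <> 0 /\ prodlim f l.
Proof.
  intros Hr HK Hf.
  assert (Hgeom : forall K', ex_series (fun i => K' * r ^ i)%R).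
  { intros K'. apply @ex_series_scal_l.
    apply ex_series_geom. rewrite Rabs_right; lra. }
  assert (Hs : ex_series (fun i => Cmod (f i - 1))).
  { apply (ex_series_le (K := R_AbsRing) (V := R_CompleteNormedModule)) with (2 := Hgeom K).
    intros i. change norm with Rabs. rewrite Rabs_right by (apply Rle_ge, Cmod_ge_0).
    apply HK. }
  destruct (prodlim_ex f Hs) as [l Hl].
  (* As soon as |f - 1| < 1/2 one has |f| >= 1/2, hence |1/f - 1| <= 2 |f - 1|. *)
  assert (Hg : ex_series (fun i => Cmod (/ f i - 1))).
  { pose proof (ex_series_lim_0 _ Hs) as H0. apply is_lim_seq_spec in H0.
    assert (Hp : (0 < 1 / 2)%R) by lra.
    destruct (H0 (mkposreal _ Hp)) as [N HN]. simpl in HN.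
    apply (ex_series_incr_n (K := R_AbsRing) (V := R_NormedModule) _ N).
    apply (ex_series_le (K := R_AbsRing) (V := R_CompleteNormedModule)) with
      (b := fun k => (2 * Cmod (f (N + k)%nat - 1))%R).
    - intros k. change norm with Rabs. rewrite Rabs_right by (apply Rle_ge, Cmod_ge_0).
      assert (HNk : (Cmod (f (N + k)%nat - 1) < 1 / 2)%R).
      { specialize (HN (N + k)%nat ltac:(lia)). rewrite Rminus_0_r, Rabs_right in HN; [lra|].
        apply Rle_ge, Cmod_ge_0. }
      set (z := f (N + k)%nat) in *. assert (Hz : z <> 0) by apply Hf.
      assert (Hz2 : (1 / 2 <= Cmod z)%R).
      { assert (H1 : (Cmod 1 <= Cmod z + Cmod (z - 1))%R).
        { replace (RtoC 1) with (z + - (z - 1)) at 1 by ring.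
          eapply Rle_trans; [apply Cmod_triangle|]. rewrite Cmod_opp. lra. }
        rewrite Cmod_1 in H1. lra. }
      replace (/ z - 1) with (- (z - 1) * / z) by (field; exact Hz).
      rewrite Cmod_mult, Cmod_opp, Cmod_inv by exact Hz.
      rewrite Rmult_comm. apply Rmult_le_compat_r; [apply Cmod_ge_0|].
      replace 2%R with (/ (1 / 2))%R by field. apply Rinv_le_contravar; lra.
    - apply @ex_series_scal_l.
      now apply (ex_series_incr_n (K := R_AbsRing) (V := R_NormedModule) _ N) in Hs. }
  destruct (prodlim_ex _ Hg) as [m Hm].
  exists l. split; [|exact Hl]. intros ->.
  apply C1_nz. transitivity (0 * m); [|ring].
  apply limC_unique with (2 := prodlim_mult _ _ _ _ Hl Hm).
  apply limC_ext with (fun _ => RtoC 1); [|apply limC_const].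
  intros n. rewrite cprod_mult, cprod_inv by exact Hf.
  rewrite Cinv_r; auto using cprod_neq_0.
Qed.

(** * The Jacobi triple product *)

Fixpoint csum (f : nat -> C) (n : nat) : C :=
  match n with O => 0 | S m => csum f m + f m end.

Lemma csum_ext (f g : nat -> C) (n : nat) :
  (forall i, (i < n)%nat -> f i = g i) -> csum f n = csum g n.
Proof.
  induction n as [|n IH]; intros H; [reflexivity|]. simpl. rewrite IH, H; auto.
Qed.

Lemma csum_plus (f g : nat -> C) (n : nat) :
  csum (fun i => f i + g i) n = csum f n + csum g n.
Proof. induction n as [|n IH]; simpl; [|rewrite IH]; ring. Qed.

Lemma csum_scal (c : C) (f : nat -> C) (n : nat) :
  csum (fun i => c * f i) n = c * csum f n.
Proof. induction n as [|n IH]; simpl; [|rewrite IH]; ring. Qed.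

Lemma csum_add (f : nat -> C) (m n : nat) :
  csum f (m + n) = csum f m + csum (fun i => f (m + i)%nat) n.
Proof.
  induction n as [|n IH]; simpl; [rewrite Nat.add_0_r; ring|].
  rewrite Nat.add_succ_r. simpl. rewrite IH. ring.
Qed.

Lemma csum_S_l (f : nat -> C) (n : nat) :
  csum f (S n) = f O + csum (fun i => f (S i)) n.
Proof. change (S n) with (1 + n)%nat. rewrite csum_add. simpl. ring. Qed.

Lemma csum_rev (f : nat -> C) (n : nat) :
  csum f n = csum (fun i => f (n - S i)%nat) n.
Proof.
  induction n as [|n IH]; [reflexivity|].
  rewrite (csum_S_l (fun i => f (S n - S i)%nat)). cbn [csum]. rewrite IH.
  replace (S n - 1)%nat with n by lia. rewrite Cplus_comm.
  reflexivity.
Qed.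

Lemma limC_csum (f : nat -> nat -> C) (n : nat) :
  (forall i, limC (fun N => f N i) 0) -> limC (fun N => csum (f N) n) 0.
Proof.
  intros H. induction n as [|n IH]; simpl; [apply limC_const|].
  replace (RtoC 0) with (0 + 0) by ring. now apply limC_plus.
Qed.

(** Dominated convergence for sums whose length grows with N: a tail of B bounds all but finitely
    many terms uniformly in N, and the remaining ones tend to 0 one by one. *)
Lemma tannery (f : nat -> nat -> C) (B : nat -> R) :
  (forall N n, (n < N)%nat -> (Cmod (f N n) <= B n)%R) -> ex_series B ->
  (forall n, limC (fun N => f N n) 0) -> limC (fun N => csum (f N) N) 0.
Proof.
  intros HB [s Hs] Hf. apply is_lim_seq_spec. intros [e He]. simpl.
  assert (He2 : (0 < e / 4)%R) by lra.
  assert (Hs' : is_lim_seq (sum_n B) s) by exact Hs. apply is_lim_seq_spec in Hs'.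
  destruct (Hs' (mkposreal _ He2)) as [n0 Hn0]. simpl in Hn0.
  pose proof (limC_csum f (S n0) Hf) as H1. apply is_lim_seq_spec in H1.
  destruct (H1 (mkposreal _ He2)) as [N1 HN1]. simpl in HN1.
  exists (N1 + S n0)%nat. intros N HN.
  assert (Htail : forall m, (S n0 + m <= N)%nat ->
    (Cmod (csum (fun i => f N (S n0 + i)%nat) m) <= sum_n B (n0 + m) - sum_n B n0)%R).
  { induction m as [|m IH]; intros Hm.
    - simpl. rewrite Cmod_0, Nat.add_0_r. lra.
    - cbn [csum]. eapply Rle_trans; [apply Cmod_triangle|].
      rewrite Nat.add_succ_r, sum_Sn. change plus with Rplus.
      specialize (IH ltac:(lia)). specialize (HB N (S n0 + m)%nat ltac:(lia)).
      simpl in HB |- *. simpl in IH. lra. }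
  rewrite Rminus_0_r, Rabs_right by (apply Rle_ge, Cmod_ge_0).
  replace (csum (f N) N - 0) with (csum (f N) (S n0 + (N - S n0)))
    by (replace (S n0 + (N - S n0))%nat with N by lia; ring).
  rewrite csum_add. eapply Rle_lt_trans; [apply Cmod_triangle|].
  specialize (Htail (N - S n0)%nat ltac:(lia)).
  specialize (HN1 N ltac:(lia)).
  rewrite Rminus_0_r, Rabs_right in HN1 by (apply Rle_ge, Cmod_ge_0).
  change (csum (f N) n0 + f N n0 - 0) with (csum (f N) (S n0) - 0) in HN1.
  replace (csum (f N) (S n0) - 0) with (csum (f N) (S n0)) in HN1 by ring.
  pose proof (Hn0 n0 ltac:(lia)) as Ha.
  pose proof (Hn0 (n0 + (N - S n0))%nat ltac:(lia)) as Hb.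
  apply Rabs_def2 in Ha. apply Rabs_def2 in Hb. lra.
Qed.

(** * Gaussian binomials and the finite triple product *)

Definition qpoch (q : C) : nat -> C := cprod (fun i => 1 - q ^ S i).

(** Defined by the q-Pascal rule, hence free of division; [qbinom_qpoch] is the usual quotient
    formula cleared of denominators. *)
Fixpoint qbinom (q : C) (n j : nat) : C :=
  match n, j with
  | _, O => 1
  | O, S _ => 0
  | S m, S k => q ^ S k * qbinom q m (S k) + qbinom q m k
  end.

Lemma qbinom_0_r (q : C) (n : nat) : qbinom q n 0 = 1.
Proof. now destruct n. Qed.

Lemma qbinom_gt (q : C) (n j : nat) : (n < j)%nat -> qbinom q n j = 0.
Proof.
  revert j. induction n as [|n IH]; intros [|j] H; try lia; simpl; [reflexivity|].
  rewrite !IH by lia. ring.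
Qed.

Lemma qbinom_diag (q : C) (n : nat) : qbinom q n n = 1.
Proof.
  induction n as [|n IH]; simpl; [reflexivity|]. rewrite IH, qbinom_gt by lia. ring.
Qed.

Lemma qbinom_qpoch (q : C) (i j : nat) :
  qbinom q (i + j) j * (qpoch q i * qpoch q j) = qpoch q (i + j).
Proof.
  remember (i + j)%nat as s eqn:Hs. revert i j Hs.
  induction s as [|s IH]; intros i j Hs.
  - replace i with O by lia. replace j with O by lia. simpl. change (qpoch q 0) with (RtoC 1). ring.
  - destruct i as [|i]; [|destruct j as [|j]].
    + simpl in Hs. subst j. rewrite qbinom_diag. change (qpoch q 0) with (RtoC 1). ring.
    + replace (S s) with (S i) by lia. rewrite qbinom_0_r. change (qpoch q 0) with (RtoC 1). ring.
    + cbn [qbinom].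
      assert (H1 := IH i (S j) ltac:(lia)). assert (H2 := IH (S i) j ltac:(lia)).
      unfold qpoch in *. cbn [cprod] in *.
      (* Splits 1 - q^(i+j+2) as q^(j+1) (1 - q^(i+1)) + (1 - q^(j+1)), one summand for each term of
         the Pascal rule. *)
      transitivity (q ^ S j * (1 - q ^ S i) * cprod (fun i => 1 - q ^ S i) s
        + (1 - q ^ S j) * cprod (fun i => 1 - q ^ S i) s).
      * rewrite <- H1 at 1. rewrite <- H2. ring.
      * replace (q ^ S s) with (q ^ S j * q ^ S i) by (rewrite <- Cpow_add_r; f_equal; lia). ring.
Qed.

(** [tterm x q n] is (-x)^n q^(n(n-1)/2). *)
Definition tterm (x q : C) : nat -> C := cprod (fun i => - x * q ^ i).

Lemma tterm_S (x q : C) (n : nat) : tterm x q (S n) = - x * tterm (x * q) q n.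
Proof.
  unfold tterm. rewrite cprod_S_l. simpl Cpow. rewrite Cmult_1_r. f_equal.
  apply cprod_ext. intros. simpl. ring.
Qed.

Lemma tterm_mul (x q : C) (n : nat) : tterm (x * q) q n = q ^ n * tterm x q n.
Proof.
  unfold tterm. induction n as [|n IH]; simpl; [ring|]. rewrite IH. ring.
Qed.

Lemma tterm_add (x q : C) (m n : nat) :
  tterm x q (m + n) = tterm x q m * tterm (x * q ^ m) q n.
Proof.
  unfold tterm. rewrite cprod_add. f_equal. apply cprod_ext. intros.
  rewrite Cpow_add_r. ring.
Qed.

Lemma tterm_neq_0 (x q : C) (n : nat) : x <> 0 -> q <> 0 -> tterm x q n <> 0.
Proof.
  intros Hx Hq. apply cprod_neq_0. intros i H.
  apply (Cmult_neq_0 x (q ^ i)); auto using Cpow_nz.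
  replace (x * q ^ i) with (- (- x * q ^ i)) by ring. rewrite H. ring.
Qed.

(** The factors of the second product are the inverses of those of the first, in reverse order. *)
Lemma tterm_reflect (z q : C) (n : nat) :
  z <> 0 -> q <> 0 -> tterm z q n * tterm (q / (z * q ^ n)) q n = 1.
Proof.
  intros Hz Hq. revert z Hz. induction n as [|n IH]; intros z Hz; [unfold tterm; simpl; ring|].
  rewrite (tterm_S z). specialize (IH (z * q) ltac:(now apply Cmult_neq_0)).
  unfold tterm at 2. cbn [cprod]. fold (tterm (q / (z * q ^ S n)) q n).
  replace (q / (z * q ^ S n)) with (q / (z * q * q ^ n))
    by (simpl; field; repeat split; auto using Cpow_nz).
  transitivity (- z * (- (q / (z * q * q ^ n)) * q ^ n)
    * (tterm (z * q) q n * tterm (q / (z * q * q ^ n)) q n)); [ring|].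
  rewrite IH. field. repeat split; auto using Cpow_nz.
Qed.

Lemma Cmult_cancel_l (c x y : C) : c <> 0 -> c * x = c * y -> x = y.
Proof.
  intros Hc H. replace x with (/ c * (c * x)) by (field; exact Hc).
  rewrite H. field. exact Hc.
Qed.

(** Peeling off the factor at i = 0 leaves the product for y q; the two sums arising from 1 - y are
    the two terms of the Pascal rule. *)
Lemma qbinomial_theorem (y q : C) (n : nat) :
  cprod (fun i => 1 - y * q ^ i) n = csum (fun j => qbinom q n j * tterm y q j) (S n).
Proof.
  revert y. induction n as [|n IH]; intros y.
  - unfold tterm. simpl. ring.
  - rewrite cprod_S_l.
    rewrite (cprod_ext _ (fun i => 1 - (y * q) * q ^ i)) by (intros; simpl; ring).
    rewrite IH. rewrite (csum_S_l _ (S n)).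
    transitivity (csum (fun j => q ^ j * qbinom q n j * tterm y q j) (S (S n))
      + csum (fun j => qbinom q n j * tterm y q (S j)) (S n)).
    + change (csum (fun j => q ^ j * qbinom q n j * tterm y q j) (S (S n)))
        with (csum (fun j => q ^ j * qbinom q n j * tterm y q j) (S n)
          + q ^ S n * qbinom q n (S n) * tterm y q (S n)).
      rewrite (qbinom_gt q n (S n)) by lia.
      rewrite (csum_ext (fun j => qbinom q n j * tterm y q (S j))
        (fun j => - y * (qbinom q n j * tterm (y * q) q j)))
        by (intros; rewrite tterm_S; ring).
      rewrite csum_scal.
      rewrite (csum_ext (fun j => q ^ j * qbinom q n j * tterm y q j)
        (fun j => qbinom q n j * tterm (y * q) q j))
        by (intros; rewrite tterm_mul; ring).
      simpl Cpow. ring.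
    + rewrite (csum_S_l _ (S n)), !qbinom_0_r. change (tterm y q 0) with (RtoC 1).
      rewrite <- Cplus_assoc, <- csum_plus. f_equal; [simpl; ring|].
      apply csum_ext. intros j _. cbn [qbinom]. ring.
Qed.

(** The symmetric partial sum over |n| <= N of the bilateral series of (-x)^n q^(n(n-1)/2): passing
    from x to q/x turns the index n into -n. *)
Definition theta_sum (x q : C) (N : nat) : C :=
  1 + csum (fun n => tterm x q (S n) + tterm (q / x) q (S n)) N.

(** The q-binomial theorem with 2N factors at y = x / q^N, divided by its central term
    [tterm y q N]. *)
Lemma finite_triple_product (x q : C) (N : nat) :
  x <> 0 -> q <> 0 ->
  cprod (fun i => (1 - x * q ^ i) * (1 - q ^ S i / x)) N =
  qbinom q (N + N) N
  + csum (fun n => qbinom q (N + N) (N + S n) * tterm x q (S n)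
                   + qbinom q (N + N) (N - S n) * tterm (q / x) q (S n)) N.
Proof.
  intros Hx Hq. set (y := x / q ^ N).
  assert (HqN : q ^ N <> 0) by now apply Cpow_nz.
  assert (Hy : y <> 0) by (intros H; apply Hx; replace x with (y * q ^ N)
    by (unfold y; field; auto); rewrite H; ring).
  assert (HyN : y * q ^ N = x) by (unfold y; field; auto).
  apply Cmult_cancel_l with (tterm y q N); [now apply tterm_neq_0|].
  rewrite cprod_mult.
  (* Each 1 - z q^i equals -z q^i times 1 - 1/(z q^i), and the latter factors are listed in reverse
     order. *)
  assert (H1 : forall (n : nat) (z : C), z <> 0 ->
    cprod (fun i => 1 - z * q ^ i) n
    = tterm z q n * cprod (fun i => 1 - q ^ S i / (z * q ^ n)) n).
  { induction n as [|n IH]; intros z Hz; [unfold tterm; simpl; ring|].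
    rewrite cprod_S_l, tterm_S. cbn [cprod].
    rewrite (cprod_ext _ (fun i => 1 - (z * q) * q ^ i)) by (intros; simpl; ring).
    rewrite IH by now apply Cmult_neq_0.
    rewrite (cprod_ext (fun i => 1 - q ^ S i / (z * q ^ S n))
      (fun i => 1 - q ^ S i / (z * q * q ^ n))) 
      by (intros; replace (z * q ^ S n) with (z * q * q ^ n) by (simpl; ring); reflexivity).
    simpl Cpow. rewrite Cmult_1_r. field. repeat split; auto using Cpow_nz. }
  transitivity (cprod (fun i => 1 - y * q ^ i) (N + N)).
  { rewrite cprod_add, (H1 N y Hy), HyN.
    rewrite (cprod_ext (fun i => 1 - y * q ^ (N + i)) (fun i => 1 - x * q ^ i))
      by (intros; rewrite Cpow_add_r, Cmult_assoc, HyN; reflexivity). ring. }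
  rewrite qbinomial_theorem. replace (S (N + N)) with (N + S N)%nat by lia.
  rewrite csum_add, csum_S_l, Nat.add_0_r, csum_rev, Cmult_plus_distr_l, <- csum_scal.
  rewrite Cplus_comm, <- Cplus_assoc, <- csum_plus. f_equal; [ring|].
  apply csum_ext. intros i Hi. rewrite tterm_add, HyN.
  assert (H2 : tterm y q (N - S i) = tterm y q N * tterm (q / x) q (S i)).
  { replace N with (N - S i + S i)%nat at 2 by lia.
    rewrite tterm_add. set (z := y * q ^ (N - S i)).
    assert (Hz : z * q ^ S i = x).
    { unfold z. rewrite <- Cmult_assoc, <- Cpow_add_r.
      replace (N - S i + S i)%nat with N by lia. exact HyN. }
    assert (Hz0 : z <> 0) by (apply Cmult_neq_0; auto using Cpow_nz).
    rewrite <- Hz, <- Cmult_assoc, tterm_reflect by auto. ring. }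
  rewrite H2. ring.
Qed.

(** The ratio of consecutive terms is -x q^n, which tends to 0 however large x is. *)
Lemma ex_series_tterm (x q : C) :
  x <> 0 -> q <> 0 -> (Cmod q < 1)%R -> ex_series (fun n => Cmod (tterm x q n)).
Proof.
  intros Hx Hq Hq1.
  apply ex_series_ext with (fun n => Rabs (Cmod (tterm x q n))).
  { intros n. apply Rabs_right, Rle_ge, Cmod_ge_0. }
  apply ex_series_DAlembert with 0%R; [lra| |].
  - intros n H. apply (tterm_neq_0 x q n Hx Hq). now apply Cmod_eq_0.
  - apply is_lim_seq_ext with (fun n => Cmod x * Cmod q ^ n)%R.
    + intros n. unfold tterm. cbn [cprod]. fold (tterm x q n).
      rewrite Cmod_mult, (Cmod_mult (- x)), Cmod_opp, Cmod_pow.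
      assert (H : Cmod (tterm x q n) <> 0%R)
        by (intros H; apply (tterm_neq_0 x q n Hx Hq); now apply Cmod_eq_0).
      replace (Cmod (tterm x q n) * (Cmod x * Cmod q ^ n) / Cmod (tterm x q n))%R
        with (Cmod x * Cmod q ^ n)%R by (field; exact H).
      symmetry. apply Rabs_right, Rle_ge, Rmult_le_pos; [apply Cmod_ge_0|].
      apply pow_le, Cmod_ge_0.
    + replace (Finite 0) with (Finite (Cmod x * 0)%R) by (f_equal; ring).
      apply is_lim_seq_mult'; [apply is_lim_seq_const|].
      apply is_lim_seq_geom. rewrite Rabs_right; [exact Hq1|]. apply Rle_ge, Cmod_ge_0.
Qed.

Lemma one_minus_neq_0 (z : C) : (Cmod z < 1)%R -> 1 - z <> 0.
Proof.
  intros H H0. assert (H1 : z = 1) by (replace z with (1 - (1 - z)) by ring; rewrite H0; ring).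
  rewrite H1, Cmod_1 in H. lra.
Qed.

Lemma Cmod_pow_lt_1 (q : C) (n : nat) : (Cmod q < 1)%R -> (Cmod (q ^ S n) < 1)%R.
Proof.
  intros H. rewrite Cmod_pow. simpl. pose proof (Cmod_ge_0 q).
  assert (Cmod q ^ n <= 1)%R by (rewrite <- (pow1 n); apply pow_incr; lra).
  assert (0 <= Cmod q ^ n)%R by (apply pow_le; lra). nra.
Qed.

(** The finite identity multiplied by P = (q; q)_oo. Its Gaussian coefficients are uniformly bounded
    and tend to 1/P for each fixed index, so [tannery] justifies the termwise limit. L is allowed to
    be 0. *)
Theorem jacobi_triple_product (x q L : C) :
  x <> 0 -> q <> 0 -> (Cmod q < 1)%R ->
  prodlim (fun i => (1 - q ^ S i) * ((1 - x * q ^ i) * (1 - q ^ S i / x))) L ->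
  limC (theta_sum x q) L.
Proof.
  intros Hx Hq Hq1 HL.
  assert (Hfac : forall i, 1 - q ^ S i <> 0)
    by (intros i; apply one_minus_neq_0, Cmod_pow_lt_1, Hq1).
  assert (HP : exists P : C, P <> 0 /\ limC (qpoch q) P).
  { apply prodlim_geom with (Cmod q) (Cmod q); [split; auto using Cmod_ge_0| |exact Hfac].
    intros i. replace (1 - q ^ S i - 1) with (- (q ^ S i)) by ring.
    rewrite Cmod_opp, Cmod_pow. simpl. lra. }
  destruct HP as [P [HP0 HP]].
  assert (Hnz : forall n, qpoch q n <> 0) by (intros; now apply cprod_neq_0).
  pose proof (limC_inv _ _ HP0 HP) as HPi.
  set (u := cprod (fun i => (1 - x * q ^ i) * (1 - q ^ S i / x))).
  assert (Hu : limC u (L * / P)).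
  { apply limC_ext with (fun N => cprod (fun i => (1 - q ^ S i) *
      ((1 - x * q ^ i) * (1 - q ^ S i / x))) N * / qpoch q N).
    - intros N. rewrite cprod_mult. fold (u N). fold (qpoch q N). field. apply Hnz.
    - now apply limC_mult. }
  (* The coefficients at distance n from the centre; each tends to P / P^2. *)
  set (c := fun N n : nat => qpoch q (N + N) * (/ qpoch q (N + n) * / qpoch q (N - n))).
  assert (Hc : forall n, limC (fun N => c N n) (/ P)).
  { intros n. replace (/ P) with (P * (/ P * / P)) by (field; exact HP0).
    apply limC_mult; [|apply limC_mult].
    - apply (limC_comp (fun N => N + N)%nat); [|exact HP].
      apply filterlim_eventually_ge with O. intros; lia.
    - apply (limC_comp (fun N => N + n)%nat (fun n => / qpoch q n)); [|exact HPi].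
      apply filterlim_eventually_ge with O. intros; lia.
    - apply (limC_comp (fun N => N - n)%nat (fun n => / qpoch q n)); [|exact HPi].
      apply filterlim_eventually_ge with n. intros; lia. }
  assert (Hqb : forall N n, (n <= N)%nat ->
    qbinom q (N + N) (N + n) = c N n /\ qbinom q (N + N) (N - n) = c N n).
  { intros N n Hn. unfold c.
    pose proof (qbinom_qpoch q (N - n) (N + n)) as H1.
    pose proof (qbinom_qpoch q (N + n) (N - n)) as H2.
    replace (N - n + (N + n))%nat with (N + N)%nat in H1 by lia.
    replace (N + n + (N - n))%nat with (N + N)%nat in H2 by lia.
    split; [rewrite <- H1 | rewrite <- H2]; field; auto. }
  destruct (limC_bounded _ _ HP) as [K1 [HK1 HK1b]].
  destruct (limC_bounded _ _ HPi) as [K2 [HK2 HK2b]].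
  set (K := (K1 * (K2 * K2) + Cmod (/ P))%R).
  assert (HK : forall N n, (Cmod (c N n - / P) <= K)%R).
  { intros N n. eapply Rle_trans; [apply Cmod_triangle|]. rewrite Cmod_opp.
    apply Rplus_le_compat_r. unfold c. rewrite !Cmod_mult.
    apply Rmult_le_compat; auto using Cmod_ge_0.
    - apply Rmult_le_pos; apply Cmod_ge_0.
    - apply Rmult_le_compat; auto using Cmod_ge_0. }
  assert (Hc0 : forall n, limC (fun N => c N n - / P) 0).
  { intros n. replace (RtoC 0) with (/ P + - / P) by ring.
    apply limC_plus; [apply Hc | apply limC_const]. }
  assert (HT : forall z : C, z <> 0 ->
    limC (fun N => csum (fun n => (c N (S n) - / P) * tterm z q (S n)) N) 0).
  { intros z Hz. apply tannery with (fun n => K * Cmod (tterm z q (S n)))%R.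
    - intros N n _. rewrite Cmod_mult. apply Rmult_le_compat_r; [apply Cmod_ge_0 | apply HK].
    - apply @ex_series_scal_l.
      apply (ex_series_incr_1 (fun n => Cmod (tterm z q n))). exact (ex_series_tterm z q Hz Hq Hq1).
    - intros n. replace (RtoC 0) with (0 * tterm z q (S n)) by ring.
      apply limC_mult; [apply Hc0 | apply limC_const]. }
  assert (Hqx : q / x <> 0).
  { intros H. apply Hq. replace q with (q / x * x) by (field; exact Hx). rewrite H. ring. }
  (* [theta_sum] is P times the finite product minus error terms, in which every coefficient c is
     replaced by c - 1/P. *)
  apply limC_ext with (fun N => P * (u N + - ((c N O - / P)
      + (csum (fun n => (c N (S n) - / P) * tterm x q (S n)) N
      + csum (fun n => (c N (S n) - / P) * tterm (q / x) q (S n)) N)))).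
  - intros N. unfold u. rewrite finite_triple_product by auto.
    destruct (Hqb N O ltac:(lia)) as [H0 _]. rewrite Nat.add_0_r in H0. rewrite H0.
    rewrite (csum_ext _ (fun n => ((c N (S n) - / P) * tterm x q (S n)
      + (c N (S n) - / P) * tterm (q / x) q (S n))
      + / P * (tterm x q (S n) + tterm (q / x) q (S n)))).
    + rewrite !csum_plus, csum_scal, csum_plus. unfold theta_sum. rewrite csum_plus. field. exact HP0.
    + intros n Hn. destruct (Hqb N (S n) ltac:(lia)) as [H1 H2]. rewrite H1, H2. ring.
  - replace L with (P * (L * / P + - (0 + (0 + 0)))) by (field; exact HP0).
    apply limC_scal, limC_plus; [exact Hu|].
    replace (- (0 + (0 + 0))) with (- (1) * (0 + (0 + 0))) by ring.
    eapply limC_ext; [|apply limC_scal; apply limC_plus;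
      [apply (Hc0 O) | apply limC_plus; [apply (HT x Hx) | apply (HT (q / x) Hqx)]]].
    intros N. cbv beta. ring.
Qed.

(** * Dissection of the theta series at fifth roots of unity *)

(** In equational form, so that [ring] can reduce modulo it: z^5 = 1 and the resulting formula for
    z^4 are the rewriting rules handed to [ring] from here on. *)
Definition cyclotomic5 (z : C) : Prop := 1 + z + z ^ 2 + z ^ 3 + z ^ 4 = 0.

Lemma cyclotomic5_pow4 (z : C) : cyclotomic5 z -> z ^ 4 = - (1) - z - z ^ 2 - z ^ 3.
Proof.
  intros H. replace (z ^ 4) with (1 + z + z ^ 2 + z ^ 3 + z ^ 4 - 1 - z - z ^ 2 - z ^ 3) by ring.
  rewrite H. ring.
Qed.

Lemma cyclotomic5_pow5 (z : C) : cyclotomic5 z -> z ^ 5 = 1.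
Proof.
  intros H. replace (z ^ 5) with (1 + (z - 1) * (1 + z + z ^ 2 + z ^ 3 + z ^ 4)) by ring.
  rewrite H. ring.
Qed.

Lemma cyclotomic5_neq_0 (z : C) : cyclotomic5 z -> z <> 0.
Proof.
  intros H ->. apply C1_nz. rewrite <- H. ring.
Qed.

Lemma cyclotomic5_neq_1 (z : C) : cyclotomic5 z -> 1 - z <> 0.
Proof.
  intros H H1. assert (Hz : z = 1) by (replace z with (1 - (1 - z)) by ring; rewrite H1; ring).
  subst z. unfold cyclotomic5 in H. apply (f_equal Re) in H. simpl in H. lra.
Qed.

Lemma cyclotomic5_inv (z : C) : cyclotomic5 z -> / z = z ^ 4.
Proof.
  intros H. pose proof (cyclotomic5_neq_0 z H). pose proof (cyclotomic5_pow5 z H) as H5.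
  replace (z ^ 4) with (z ^ 5 / z) by (simpl; field; auto). rewrite H5. field. auto.
Qed.

Lemma cyclotomic5_pow (z : C) (k : nat) :
  cyclotomic5 z -> (k = 2 \/ k = 3 \/ k = 4)%nat -> cyclotomic5 (z ^ k).
Proof.
  intros H [-> | [-> | ->]]; unfold cyclotomic5; pose proof (cyclotomic5_pow5 z H) as H5;
    rewrite <- H; ring [H5].
Qed.

Lemma primitive_root_cyclotomic5 (z : C) : primitive_root 5 z -> cyclotomic5 z.
Proof.
  intros [_ [H5 H1]]. unfold cyclotomic5.
  assert (Hz : z - 1 <> 0).
  { intros H. apply (H1 1%nat ltac:(lia)). rewrite Cpow_1_r.
    replace z with (z - 1 + 1) by ring. rewrite H. ring. }
  apply Cmult_cancel_l with (z - 1); [exact Hz|].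
  transitivity (z ^ 5 - 1); [ring | rewrite H5; ring].
Qed.

Lemma tterm_S_r (x q : C) (n : nat) : tterm x q (S n) = tterm x q n * (- x * q ^ n).
Proof. reflexivity. Qed.

(** The five factors with exponents 5m + i up to 5m + i + 4 multiply to -y^5 q^(5i+10) (q^25)^m, so
    the terms along a residue class modulo 5 form a theta series in q^25. *)
Lemma tterm_pow5 (y q : C) (m i : nat) :
  tterm y q (5 * m + i) = tterm y q i * tterm (y ^ 5 * q ^ (5 * i + 10)) (q ^ 25) m.
Proof.
  induction m as [|m IH].
  - change (5 * 0 + i)%nat with i. unfold tterm at 3. simpl cprod. ring.
  - replace (5 * S m + i)%nat with (S (S (S (S (S (5 * m + i)))))) by lia.
    rewrite !tterm_S_r, IH, <- Cpow_mult_r.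
    rewrite !Cpow_S, !Cpow_add_r.
    replace (25 * m)%nat with (5 * m + (5 * m + (5 * m + (5 * m + 5 * m))))%nat by lia.
    replace (5 * i)%nat with (i + (i + (i + (i + i))))%nat by lia.
    rewrite !Cpow_add_r. ring.
Qed.

Lemma theta_sum_S (x q : C) (N : nat) :
  theta_sum x q (S N) = theta_sum x q N + (tterm x q (S N) + tterm (q / x) q (S N)).
Proof. unfold theta_sum. simpl csum. ring. Qed.

(** The length 5M + 2 makes the indices from -5M-2 to 5M+2 fill each residue class modulo 5 with
    exactly 2M+1 terms, the symmetric partial sum of a theta series in q^25; z^n is constant on a
    class. *)
Lemma theta_sum_dissection (z q : C) (M : nat) :
  cyclotomic5 z -> q <> 0 ->
  theta_sum z q (5 * M + 2) =
  theta_sum (q ^ 10) (q ^ 25) M - z * theta_sum (q ^ 15) (q ^ 25) M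
  + z ^ 2 * q * theta_sum (q ^ 20) (q ^ 25) M - z ^ 4 * q * theta_sum (q ^ 5) (q ^ 25) M
  + z ^ 3 * q ^ 3 * theta_sum 1 (q ^ 25) M.
Proof.
  intros Hz Hq. pose proof (cyclotomic5_pow5 z Hz) as H5.
  assert (Hqz : q / z = q * z ^ 4)
    by (unfold Cdiv; rewrite (cyclotomic5_inv z Hz); reflexivity).
  assert (Hdiv : forall a b : nat, (a + b = 25)%nat -> q ^ 25 / q ^ a = q ^ b).
  { intros a b H. rewrite <- H, Cpow_add_r. field. now apply Cpow_nz. }
  induction M as [|M IH].
  - unfold theta_sum. simpl csum. unfold tterm. simpl cprod. rewrite Hqz. ring [H5].
  - replace (5 * S M + 2)%nat with (S (S (S (S (S (5 * M + 2)))))) by lia.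
    rewrite !theta_sum_S, IH. clear IH.
    rewrite (Hdiv 10%nat 15%nat), (Hdiv 15%nat 10%nat), (Hdiv 20%nat 5%nat),
      (Hdiv 5%nat 20%nat) by reflexivity.
    replace (q ^ 25 / 1) with (q ^ 25) by (field; apply C1_nz).
    rewrite !(tterm_S _ (q ^ 25) M), <- !Cpow_add_r, Cmult_1_l.
    replace (S (5 * M + 2)) with (5 * M + 3)%nat by lia.
    replace (S (5 * M + 3)) with (5 * M + 4)%nat by lia.
    replace (S (5 * M + 4)) with (5 * M + 5)%nat by lia.
    replace (S (5 * M + 5)) with (5 * M + 6)%nat by lia.
    replace (S (5 * M + 6)) with (5 * M + 7)%nat by lia.
    rewrite !tterm_pow5, Hqz, H5.
    replace ((q * z ^ 4) ^ 5) with (q ^ 5) by (ring [H5]).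
    rewrite <- !Cpow_add_r, !Cmult_1_l.
    cbn [Nat.add Nat.mul].
    assert (Hk : forall x : C, tterm x q 3 = - x ^ 3 * q ^ 3 /\ tterm x q 4 = x ^ 4 * q ^ 6 /\
      tterm x q 5 = - x ^ 5 * q ^ 10 /\ tterm x q 6 = x ^ 6 * q ^ 15 /\
      tterm x q 7 = - x ^ 7 * q ^ 21)
      by (intros x; unfold tterm; cbn [cprod]; repeat split; ring).
    destruct (Hk z) as (-> & -> & -> & -> & ->).
    destruct (Hk (q * z ^ 4)) as (-> & -> & -> & -> & ->).
    ring [H5].
Qed.

(** If |z| > 1, then z^4 = 1/z has modulus below 1, and so has its fourth power z^16 = z. *)
Lemma cyclotomic5_Cmod (z : C) : cyclotomic5 z -> (Cmod z <= 1)%R.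
Proof.
  intros H. destruct (Rle_lt_dec (Cmod z) 1) as [|Hgt]; [assumption|].
  assert (H4 : (Cmod (z ^ 4) < 1)%R).
  { rewrite <- (cyclotomic5_inv z H), Cmod_inv by now apply cyclotomic5_neq_0.
    rewrite <- Rinv_1. apply Rinv_lt_contravar; lra. }
  apply (Cmod_pow_lt_1 _ 3) in H4. rewrite <- Cpow_mult_r in H4.
  change (4 * 4)%nat with (5 + (5 + (5 + 1)))%nat in H4.
  rewrite !Cpow_add_r, (cyclotomic5_pow5 z H), Cpow_1_r, !Cmult_1_l in H4. lra.
Qed.

Lemma prodlim_one_minus (w r : C) :
  (Cmod w < 1)%R -> (Cmod r < 1)%R ->
  exists l : C, l <> 0 /\ prodlim (fun i => 1 - w * r ^ i) l.
Proof.
  intros Hw Hr. pose proof (Cmod_ge_0 w). pose proof (Cmod_ge_0 r).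
  apply prodlim_geom with 1%R (Cmod r); [lra| |].
  - intros i. replace (1 - w * r ^ i - 1) with (- (w * r ^ i)) by ring.
    rewrite Cmod_opp, Cmod_mult, Cmod_pow.
    apply Rmult_le_compat_r; [apply pow_le|]; lra.
  - intros i. apply one_minus_neq_0. rewrite Cmod_mult, Cmod_pow.
    assert (Cmod r ^ i <= 1)%R by (rewrite <- (pow1 i); apply pow_incr; lra).
    assert (0 <= Cmod r ^ i)%R by (apply pow_le; lra). nra.
Qed.

Lemma prodlim_unique (f : nat -> C) (l m : C) : prodlim f l -> prodlim f m -> l = m.
Proof. apply limC_unique. Qed.

(* The factors of (q, zq, q/z; q)_oo, with 1/z written z^4. *)
Definition theta_factor (z q : C) (i : nat) : C :=
  (1 - q ^ S i) * ((1 - z * q ^ S i) * (1 - z ^ 4 * q ^ S i)).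

Lemma prodlim_theta_factor (z q : C) :
  (Cmod z <= 1)%R -> (Cmod q < 1)%R ->
  exists l : C, l <> 0 /\ prodlim (theta_factor z q) l.
Proof.
  intros Hz Hq.
  assert (H : forall w, (Cmod w <= 1)%R ->
    exists l : C, l <> 0 /\ prodlim (fun i => 1 - w * q ^ S i) l).
  { intros w Hw. destruct (prodlim_one_minus (w * q) q) as [l [Hl Hp]]; [|exact Hq|].
    - rewrite Cmod_mult. pose proof (Cmod_ge_0 w). pose proof (Cmod_ge_0 q). nra.
    - exists l. split; [exact Hl|].
      eapply prodlim_ext; [|exact Hp]. intros i. simpl. ring. }
  assert (Hz4 : (Cmod (z ^ 4) <= 1)%R).
  { rewrite Cmod_pow, <- (pow1 4). apply pow_incr. split; [apply Cmod_ge_0 | exact Hz]. }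
  destruct (H 1) as [l0 [Hl0 Hp0]]; [rewrite Cmod_1; lra|].
  destruct (H z Hz) as [l1 [Hl1 Hp1]]. destruct (H (z ^ 4) Hz4) as [l2 [Hl2 Hp2]].
  exists (l0 * (l1 * l2)). split; [repeat apply Cmult_neq_0; auto|].
  unfold theta_factor. apply prodlim_mult; [|now apply prodlim_mult].
  eapply prodlim_ext; [|exact Hp0]. intros i. simpl. ring.
Qed.

(** [rr_num] and [rr_den] are the numerator and denominator of the product in [rr], in blocks of
    five. The common factor 1 - q^(5i+5) cancels in the quotient and makes each of them a triple
    product. *)
Definition rr_num (q : C) (i : nat) : C :=
  (1 - q ^ (5 * i + 5)) * ((1 - q ^ (5 * i + 1)) * (1 - q ^ (5 * i + 4))).

Definition rr_den (q : C) (i : nat) : C :=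
  (1 - q ^ (5 * i + 5)) * ((1 - q ^ (5 * i + 2)) * (1 - q ^ (5 * i + 3))).

Lemma prodlim_block (q : C) (j k : nat) :
  (Cmod q < 1)%R ->
  exists l : C, l <> 0 /\ prodlim (fun i => (1 - q ^ (5 * i + 5)) *
    ((1 - q ^ (5 * i + S j)) * (1 - q ^ (5 * i + S k)))) l.
Proof.
  intros Hq.
  assert (H : forall j, exists l : C, l <> 0 /\ prodlim (fun i => 1 - q ^ (5 * i + S j)) l).
  { clear j. intros j.
    destruct (prodlim_one_minus (q ^ S j) (q ^ 5)) as [l [Hl Hp]];
      try now apply Cmod_pow_lt_1.
    exists l. split; [exact Hl|]. eapply prodlim_ext; [|exact Hp].
    intros i. cbv beta. rewrite Cpow_add_r, Cpow_mult_r. ring. }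
  destruct (H 4%nat) as [l0 [Hl0 Hp0]].
  destruct (H j) as [l1 [Hl1 Hp1]]. destruct (H k) as [l2 [Hl2 Hp2]].
  exists (l0 * (l1 * l2)). split; [repeat apply Cmult_neq_0; auto|].
  apply prodlim_mult; [exact Hp0 | now apply prodlim_mult].
Qed.

(** In the dissection the theta series at q^10 and q^15 agree, as do those at q^20 and q^5, and the
    one at 1 vanishes. What remains is (1 - z) a + (z^2 - z^4) q c, and z^2 - z^4 = (1 - z)(z^2 +
    z^3). *)
Lemma prodlim_theta_linear (z q a c : C) :
  cyclotomic5 z -> q <> 0 -> (Cmod q < 1)%R ->
  prodlim (rr_den (q ^ 5)) a -> prodlim (rr_num (q ^ 5)) c ->
  prodlim (theta_factor z q) (a + (z ^ 2 + z ^ 3) * (q * c)).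
Proof.
  intros Hz Hq Hq1 Ha Hc.
  pose proof (cyclotomic5_neq_0 z Hz) as Hz0.
  assert (HQ : q ^ 25 <> 0) by now apply Cpow_nz.
  assert (HQ1 : (Cmod (q ^ 25) < 1)%R) by now apply Cmod_pow_lt_1.
  destruct (prodlim_theta_factor z q (cyclotomic5_Cmod z Hz) Hq1) as [m [_ Hm]].
  assert (Hth : limC (theta_sum z q) ((1 - z) * m)).
  { apply jacobi_triple_product; auto.
    assert (Hnz : forall N, 1 - z * q ^ N <> 0).
    { intros [|N]; [change (q ^ 0) with (RtoC 1); rewrite Cmult_1_r; now apply cyclotomic5_neq_1|].
      apply one_minus_neq_0. rewrite Cmod_mult.
      pose proof (Cmod_pow_lt_1 q N Hq1). pose proof (Cmod_ge_0 (q ^ S N)).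
      pose proof (cyclotomic5_Cmod z Hz). pose proof (Cmod_ge_0 z). nra. }
    (* The triple product at x = z has the factors 1 - z q^i from i = 0 on, [theta_factor] those
       from i = 1 on; the discrepancy is (1 - z)/(1 - z q^N), with denominator tending to 1. *)
    apply limC_ext with (fun N => (1 - z) * cprod (theta_factor z q) N * / (1 - z * q ^ N)).
    - intros N. induction N as [|N IH].
      + simpl. rewrite Cmult_1_r. field. now apply cyclotomic5_neq_1.
      + cbn [cprod]. rewrite <- IH. unfold theta_factor at 2.
        replace (q ^ S N / z) with (z ^ 4 * q ^ S N)
          by (unfold Cdiv; rewrite (cyclotomic5_inv z Hz); ring).
        pose proof (Hnz N). pose proof (Hnz (S N)). field. split; assumption.
    - replace ((1 - z) * m) with ((1 - z) * m * / (1 + - z * 0)) by (field; apply C1_nz).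
      apply limC_mult; [now apply limC_scal|]. apply limC_inv.
      + replace (1 + - z * 0) with (RtoC 1) by ring. apply C1_nz.
      + apply limC_ext with (fun N => 1 + - z * q ^ N); [intros; ring|].
        apply limC_plus; [apply limC_const|]. apply limC_scal.
        apply is_lim_seq_ext with (fun n => Cmod q ^ n)%R.
        * intros n. rewrite <- Cmod_pow. f_equal. ring.
        * apply is_lim_seq_geom. rewrite Rabs_right; [exact Hq1|]. apply Rle_ge, Cmod_ge_0. }
  assert (Hpow : forall (b e : nat), (b + e = 25)%nat -> forall l,
    prodlim (fun i => (1 - (q ^ 5) ^ (5 * i + 5)) *
      ((1 - q ^ b * (q ^ 25) ^ i) * (1 - q ^ e * (q ^ 25) ^ i))) l ->
    limC (theta_sum (q ^ b) (q ^ 25)) l).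
  { intros b e Hbe l Hl. apply jacobi_triple_product; auto using Cpow_nz.
    eapply prodlim_ext; [|exact Hl]. intros i. cbv beta.
    rewrite <- !Cpow_mult_r.
    replace (25 * S i)%nat with (5 * (5 * i + 5))%nat by lia.
    replace (q ^ (5 * (5 * i + 5))) with (q ^ b * (q ^ e * q ^ (25 * i))) at 3
      by (rewrite <- !Cpow_add_r; f_equal; lia).
    f_equal. f_equal. field. now apply Cpow_nz. }
  assert (Hblock : forall b e j k : nat, (b = 5 * j)%nat -> (e = 5 * k)%nat -> forall i,
    (1 - (q ^ 5) ^ (5 * i + j)) * (1 - (q ^ 5) ^ (5 * i + k))
    = (1 - q ^ b * (q ^ 25) ^ i) * (1 - q ^ e * (q ^ 25) ^ i)).
  { intros b e j k -> -> i. rewrite <- !Cpow_mult_r, <- !Cpow_add_r.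
    replace (5 * (5 * i + j))%nat with (5 * j + 25 * i)%nat by lia.
    replace (5 * (5 * i + k))%nat with (5 * k + 25 * i)%nat by lia. reflexivity. }
  assert (H10 : limC (theta_sum (q ^ 10) (q ^ 25)) a).
  { apply (Hpow 10%nat 15%nat eq_refl). eapply prodlim_ext; [|exact Ha].
    intros i. unfold rr_den. f_equal. now apply Hblock. }
  assert (H15 : limC (theta_sum (q ^ 15) (q ^ 25)) a).
  { apply (Hpow 15%nat 10%nat eq_refl). eapply prodlim_ext; [|exact Ha].
    intros i. unfold rr_den. f_equal. rewrite Cmult_comm. now apply Hblock. }
  assert (H5 : limC (theta_sum (q ^ 5) (q ^ 25)) c).
  { apply (Hpow 5%nat 20%nat eq_refl). eapply prodlim_ext; [|exact Hc].
    intros i. unfold rr_num. f_equal. now apply Hblock. }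
  assert (H20 : limC (theta_sum (q ^ 20) (q ^ 25)) c).
  { apply (Hpow 20%nat 5%nat eq_refl). eapply prodlim_ext; [|exact Hc].
    intros i. unfold rr_num. f_equal. rewrite Cmult_comm. now apply Hblock. }
  (* At x = 1 the factor with i = 0 contains 1 - x = 0, so the product vanishes. *)
  assert (H0 : limC (theta_sum 1 (q ^ 25)) 0).
  { apply jacobi_triple_product; auto using C1_nz.
    apply limC_ext_loc with (fun _ => RtoC 0); [|apply limC_const].
    exists 1%nat. intros [|n] Hn; [lia|]. rewrite cprod_S_l. simpl (_ ^ 0). ring. }
  assert (Hm2 : (1 - z) * m = (1 - z) * (a + (z ^ 2 + z ^ 3) * (q * c))).
  { apply limC_unique with (fun M => theta_sum z q (5 * M + 2)).
    - apply (limC_comp (fun M => 5 * M + 2)%nat); [|exact Hth].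
      apply filterlim_eventually_ge with O. intros; lia.
    - replace ((1 - z) * (a + (z ^ 2 + z ^ 3) * (q * c))) with
        (a + - z * a + z ^ 2 * q * c + - (z ^ 4 * q) * c + z ^ 3 * q ^ 3 * 0) by ring.
      eapply limC_ext; [intros M; symmetry; rewrite theta_sum_dissection by auto; reflexivity|].
      eapply limC_ext; [|repeat apply limC_plus; [apply H10 | apply limC_scal, H15 |
        apply limC_scal, H20 | apply limC_scal, H5 | apply limC_scal, H0]].
      intros M. cbv beta. ring. }
  apply Cmult_cancel_l in Hm2; [|now apply cyclotomic5_neq_1]. now rewrite <- Hm2.
Qed.

(** * The relation between r(tau) and r(5 tau) *)

(** Homogeneous, so that the quartics can be evaluated at a quotient such as q c / a before
    dividing. *)
Definition quartic_num (x y : C) : C :=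
  x ^ 4 - 3 * x ^ 3 * y + 4 * x ^ 2 * y ^ 2 - 2 * x * y ^ 3 + y ^ 4.

Definition quartic_den (x y : C) : C :=
  x ^ 4 + 2 * x ^ 3 * y + 4 * x ^ 2 * y ^ 2 + 3 * x * y ^ 3 + y ^ 4.

Lemma Cexp_plus (x y : C) : Cexp (x + y) = Cexp x * Cexp y.
Proof.
  destruct x as [x1 x2], y as [y1 y2]. unfold Cexp. simpl.
  rewrite exp_plus, cos_plus, sin_plus. unfold Cmult, RtoC. simpl. f_equal; ring.
Qed.

Lemma Cmod_Cexp (x : C) : Cmod (Cexp x) = exp (Re x).
Proof.
  unfold Cexp. rewrite Cmod_mult, Cmod_R.
  rewrite Rabs_right by (left; apply exp_pos).
  replace (Cmod (cos (Im x), sin (Im x))) with 1%R; [ring|].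
  unfold Cmod. simpl. rewrite <- sqrt_1 at 1. f_equal.
  pose proof (sin2_cos2 (Im x)) as H. unfold Rsqr in H. lra.
Qed.

Lemma Cexp_neq_0 (x : C) : Cexp x <> 0.
Proof. apply Cmod_gt_0. rewrite Cmod_Cexp. apply exp_pos. Qed.

(** * The infinite product defining r *)

Lemma legendre_5 (n : nat) :
  (n mod 5 = 0 /\ legendre n 5 = 0%Z)%nat \/
  ((n mod 5 = 1 \/ n mod 5 = 4) /\ legendre n 5 = 1%Z)%nat \/
  ((n mod 5 = 2 \/ n mod 5 = 3) /\ legendre n 5 = (-1)%Z)%nat.
Proof.
  pose proof (Nat.mod_upper_bound n 5 ltac:(lia)) as H. unfold legendre.
  destruct (n mod 5)%nat as [|[|[|[|[|k]]]]]; [..|lia]; vm_compute; tauto.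
Qed.

Definition rr_factor (q : C) (i : nat) : C := Cpowz (1 - q ^ S i) (legendre (S i) 5).

Lemma rr_factor_neq_0 (q : C) (i : nat) : (Cmod q < 1)%R -> rr_factor q i <> 0.
Proof.
  intros Hq. pose proof (one_minus_neq_0 _ (Cmod_pow_lt_1 q i Hq)) as H.
  unfold rr_factor.
  destruct (legendre_5 (S i)) as [[_ ->]|[[_ ->]|[_ ->]]]; cbn [Cpowz]; simpl (Pos.to_nat 1);
    rewrite ?Cpow_1_r; [apply C1_nz | exact H |].
  now apply nonzero_div_l || (intros H0; apply C1_nz; rewrite <- (Cinv_r _ H), H0; ring).
Qed.

Lemma prodlim_rr_factor (q : C) :
  (Cmod q < 1)%R -> exists l : C, l <> 0 /\ prodlim (rr_factor q) l.
Proof.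
  intros Hq. pose proof (Cmod_ge_0 q) as Hq0.
  (* The constant bounds 1/|1 - q^n|, which enters where the Legendre symbol is -1. *)
  apply prodlim_geom with (/ (1 - Cmod q))%R (Cmod q); [lra| |intros; now apply rr_factor_neq_0].
  intros i. pose proof (one_minus_neq_0 _ (Cmod_pow_lt_1 q i Hq)) as H.
  assert (Hi : (0 <= Cmod q ^ i)%R) by (apply pow_le; lra).
  assert (Hi1 : (Cmod q ^ i <= 1)%R) by (rewrite <- (pow1 i); apply pow_incr; lra).
  assert (HK : (1 <= / (1 - Cmod q))%R).
  { rewrite <- Rinv_1 at 1. apply Rinv_le_contravar; lra. }
  assert (Hqi : Cmod (q ^ S i) = (Cmod q * Cmod q ^ i)%R) by (rewrite Cmod_pow; reflexivity).
  unfold rr_factor.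
  destruct (legendre_5 (S i)) as [[_ ->]|[[_ ->]|[_ ->]]]; cbn [Cpowz]; simpl (Pos.to_nat 1);
    rewrite ?Cpow_1_r.
  - replace (1 - 1) with (RtoC 0) by ring. rewrite Cmod_0. nra.
  - replace (1 - q ^ S i - 1) with (- (q ^ S i)) by ring. rewrite Cmod_opp, Hqi. nra.
  - replace (/ (1 - q ^ S i) - 1) with (q ^ S i / (1 - q ^ S i)) by (field; exact H).
    rewrite Cmod_div, Hqi by exact H.
    assert (H1 : (1 - Cmod q <= Cmod (1 - q ^ S i))%R).
    { assert (H2 : (Cmod 1 <= Cmod (1 - q ^ S i) + Cmod (q ^ S i))%R).
      { replace (RtoC 1) with (1 - q ^ S i + q ^ S i) at 1 by ring. apply Cmod_triangle. }
      rewrite Cmod_1, Hqi in H2. nra. }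
    apply Rle_trans with (Cmod q * Cmod q ^ i / (1 - Cmod q))%R.
    + apply Rmult_le_compat_l; [nra|]. apply Rinv_le_contravar; lra.
    + unfold Rdiv. rewrite Rmult_comm. apply Rmult_le_compat_l; [lra|]. nra.
Qed.

(** Five consecutive factors of r multiply to a quotient [rr_num] / [rr_den], and the limit r may be
    taken along multiples of 5. *)
Lemma rr_block (q a c r : C) :
  (Cmod q < 1)%R ->
  prodlim (rr_den q) a -> prodlim (rr_num q) c -> prodlim (rr_factor q) r -> r * a = c.
Proof.
  intros Hq Ha Hc Hr. apply prodlim_unique with (2 := Hc).
  apply limC_ext with (fun M => cprod (rr_factor q) (5 * M) * cprod (rr_den q) M).
  - intros M. induction M as [|M IH]; [simpl; ring|].
    replace (5 * S M)%nat with (S (S (S (S (S (5 * M)))))) by lia.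
    cbn [cprod]. rewrite <- IH.
    assert (Hleg : forall k, legendre (5 * M + k) 5 = legendre k 5).
    { intros k. unfold legendre.
      replace ((5 * M + k) mod 5)%nat with (k mod 5)%nat; [reflexivity|].
      rewrite Nat.add_comm, Nat.mul_comm, Nat.Div0.mod_add. reflexivity. }
    unfold rr_factor at 2 3 4 5 6. unfold rr_den at 2. unfold rr_num.
    replace (S (5 * M)) with (5 * M + 1)%nat by lia.
    replace (S (5 * M + 1)) with (5 * M + 2)%nat by lia.
    replace (S (5 * M + 2)) with (5 * M + 3)%nat by lia.
    replace (S (5 * M + 3)) with (5 * M + 4)%nat by lia.
    replace (S (5 * M + 4)) with (5 * M + 5)%nat by lia.
    rewrite !Hleg.
    change (legendre 1 5) with 1%Z. change (legendre 2 5) with (-1)%Z.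
    change (legendre 3 5) with (-1)%Z. change (legendre 4 5) with 1%Z.
    change (legendre 5 5) with 0%Z.
    cbn [Cpowz]. simpl (Pos.to_nat 1). rewrite !Cpow_1_r.
    pose proof (one_minus_neq_0 _ (Cmod_pow_lt_1 q (5 * M + 1) Hq)) as H2.
    pose proof (one_minus_neq_0 _ (Cmod_pow_lt_1 q (5 * M + 2) Hq)) as H3.
    replace (S (5 * M + 1)) with (5 * M + 2)%nat in H2 by lia.
    replace (S (5 * M + 2)) with (5 * M + 3)%nat in H3 by lia.
    field. split; assumption.
  - apply limC_mult; [|exact Ha].
    apply (limC_comp (fun M => 5 * M)%nat); [|exact Hr].
    apply filterlim_eventually_ge with O. intros; lia.
Qed.

(* With y = q^n and w = z^n this is the n-th factor of theta_factor z (z^k q),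
   where v = w^k. *)
Definition twisted_factor (z v y : C) : C :=
  (1 - v * y) * ((1 - z * (v * y)) * (1 - z ^ 4 * (v * y))).

Lemma theta_factor_twist (z x q : C) (k i : nat) :
  theta_factor x (z ^ k * q) i = twisted_factor x ((z ^ S i) ^ k) (q ^ S i).
Proof.
  unfold theta_factor, twisted_factor.
  replace ((z ^ k * q) ^ S i) with ((z ^ S i) ^ k * q ^ S i); [reflexivity|].
  rewrite Cpow_mult_l, <- !Cpow_mult_r. do 2 f_equal. lia.
Qed.

(** Clears denominators where the Legendre symbol is -1; there a = 1 - y and b = 1 - y^5. *)
Lemma inv_pow_swap (a b x y : C) :
  a <> 0 -> b <> 0 -> b * x = a ^ 5 * y -> (/ a) ^ 5 * x = / b * y.
Proof.
  intros Ha Hb H. replace y with (/ a ^ 5 * (a ^ 5 * y)) by (field; exact Ha).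
  rewrite <- H. field. split; assumption.
Qed.

(** For n = 1, 4 mod 5 the four twisted factors on the left multiply to ((1 - y^5)/(1 - y))^3 and
    those on the right to (1 - y)^2 (1 - y^5)^2; for n = 2, 3 mod 5 the two products change places
    along with the sign of the Legendre symbol. For n divisible by 5 one has w = 1 and both sides
    coincide. *)
Lemma rr_factor_relation (z q : C) (i : nat) :
  cyclotomic5 z -> (Cmod q < 1)%R ->
  let w := z ^ S i in let y := q ^ S i in
  rr_factor q i ^ 5 *
    (twisted_factor z (w ^ 2) y * twisted_factor z (w ^ 3) y *
     (twisted_factor (z ^ 2) (w ^ 1) y * twisted_factor (z ^ 2) (w ^ 4) y)) =
  rr_factor (q ^ 5) i *
    (twisted_factor z (w ^ 1) y * twisted_factor z (w ^ 4) y *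
     (twisted_factor (z ^ 2) (w ^ 2) y * twisted_factor (z ^ 2) (w ^ 3) y)).
Proof.
  intros Hz Hq w y.
  pose proof (cyclotomic5_pow4 z Hz) as H4. pose proof (cyclotomic5_pow5 z Hz) as H5.
  assert (Hw : w = z ^ (S i mod 5)).
  { unfold w. rewrite (Nat.div_mod_eq (S i) 5) at 1.
    rewrite Cpow_add_r, Cpow_mult_r, H5, Cpow_1_l. ring. }
  assert (Hy : 1 - y <> 0) by apply one_minus_neq_0, Cmod_pow_lt_1, Hq.
  assert (Hy5 : 1 - y ^ 5 <> 0).
  { unfold y. rewrite <- Cpow_mult_r.
    replace (S i * 5)%nat with (S (4 + i * 5))%nat by lia.
    apply one_minus_neq_0, Cmod_pow_lt_1, Hq. }
  unfold rr_factor. replace ((q ^ 5) ^ S i) with (y ^ 5)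
    by (unfold y; rewrite <- !Cpow_mult_r; f_equal; lia).
  fold y. unfold twisted_factor.
  destruct (legendre_5 (S i)) as [[Hi ->]|[[[Hi|Hi] ->]|[[Hi|Hi] ->]]];
    rewrite Hi in Hw; rewrite Hw; cbn [Cpowz]; simpl (Pos.to_nat 1); rewrite ?Cpow_1_r.
  - ring [H5].
  - ring [H5 H4].
  - ring [H5 H4].
  - apply inv_pow_swap; auto. ring [H5 H4].
  - apply inv_pow_swap; auto. ring [H5 H4].
Qed.

(** The limit form of [rr_factor_relation]: each of its eight theta products converges to a linear
    form in a and q c, and the four on either side multiply to one of the quartics. *)
Lemma prodlim_quintic (z q a c r s : C) :
  cyclotomic5 z -> q <> 0 -> (Cmod q < 1)%R ->
  prodlim (rr_den (q ^ 5)) a -> prodlim (rr_num (q ^ 5)) c ->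
  prodlim (rr_factor q) r -> prodlim (rr_factor (q ^ 5)) s ->
  r ^ 5 * quartic_den (q * c) a = s * quartic_num (q * c) a.
Proof.
  intros Hz Hq Hq1 Ha Hc Hr Hs.
  pose proof (cyclotomic5_pow5 z Hz) as H5.
  assert (H : forall x k, cyclotomic5 x ->
    prodlim (fun i => twisted_factor x ((z ^ S i) ^ k) (q ^ S i))
      (a + (x ^ 2 + x ^ 3) * (z ^ k * (q * c)))).
  { intros x k Hx.
    apply prodlim_ext with (theta_factor x (z ^ k * q)).
    { intros i. apply theta_factor_twist. }
    assert (Hzq : (z ^ k * q) ^ 5 = q ^ 5).
    { rewrite Cpow_mult_l, <- Cpow_mult_r, Nat.mul_comm, Cpow_mult_r, H5, Cpow_1_l. ring. }
    replace (z ^ k * (q * c)) with ((z ^ k * q) * c) by ring.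
    apply prodlim_theta_linear; rewrite ?Hzq; auto.
    - apply Cmult_neq_0; auto. apply Cpow_nz. now apply cyclotomic5_neq_0.
    - rewrite Cmod_mult, Cmod_pow. pose proof (cyclotomic5_Cmod z Hz).
      pose proof (Cmod_ge_0 z). pose proof (Cmod_ge_0 q).
      assert (Cmod z ^ k <= 1)%R by (rewrite <- (pow1 k); apply pow_incr; lra).
      assert (0 <= Cmod z ^ k)%R by (apply pow_le; lra). nra. }
  assert (Hz2 : cyclotomic5 (z ^ 2)) by (apply cyclotomic5_pow; auto).
  pose proof (fun k => H z k Hz) as H1. pose proof (fun k => H (z ^ 2) k Hz2) as H2.
  pose proof (prodlim_mult _ _ _ _ (prodlim_pow _ _ 5 Hr)
    (prodlim_mult _ _ _ _ (prodlim_mult _ _ _ _ (H1 2%nat) (H1 3%nat))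
      (prodlim_mult _ _ _ _ (H2 1%nat) (H2 4%nat)))) as HL.
  pose proof (prodlim_mult _ _ _ _ Hs
    (prodlim_mult _ _ _ _ (prodlim_mult _ _ _ _ (H1 1%nat) (H1 4%nat))
      (prodlim_mult _ _ _ _ (H2 2%nat) (H2 3%nat)))) as HR.
  assert (HE := prodlim_unique _ _ _ (prodlim_ext _ _ _
    (fun i => rr_factor_relation z q i Hz Hq1) HL) HR).
  clear - HE Hz H5. pose proof (cyclotomic5_pow4 z Hz) as H4.
  set (g := q * c) in *. clearbody g.
  transitivity (r ^ 5 *
     ((a + (z ^ 2 + z ^ 3) * (z ^ 2 * g)) * (a + (z ^ 2 + z ^ 3) * (z ^ 3 * g)) *
      ((a + ((z ^ 2) ^ 2 + (z ^ 2) ^ 3) * (z ^ 1 * g)) *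
       (a + ((z ^ 2) ^ 2 + (z ^ 2) ^ 3) * (z ^ 4 * g)))));
    [|rewrite HE]; f_equal; unfold quartic_den, quartic_num; ring [H5 H4].
Qed.

(* The quartics split into values of theta_factor, so none of them vanishes. *)
Lemma rr_relation (z tau : C) :
  cyclotomic5 z -> (0 < Im tau)%R ->
  let u := rr tau in let t := rr (5 * tau) in
  u <> 0 /\ t <> 0 /\ 1 - t - t ^ 2 <> 0 /\ quartic_den t 1 <> 0 /\
  u ^ 5 * quartic_den t 1 = quartic_num t 1 * t.
Proof.
  intros Hz Htau u t.
  set (q := Cexp (2 * PI * Ci * tau)).
  assert (Hq : q <> 0) by apply Cexp_neq_0.
  assert (Hq1 : (Cmod q < 1)%R).
  { unfold q. rewrite Cmod_Cexp, <- exp_0. apply exp_increasing.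
    destruct tau as [x y]. simpl in *. pose proof PI_RGT_0. nra. }
  assert (H5 : Cexp (2 * PI * Ci * (5 * tau)) = q ^ 5).
  { replace (2 * PI * Ci * (5 * tau)) with (2 * PI * Ci * tau + (2 * PI * Ci * tau +
      (2 * PI * Ci * tau + (2 * PI * Ci * tau + 2 * PI * Ci * tau)))) by ring.
    rewrite !Cexp_plus. fold q. ring. }
  assert (H5n : RtoC 5 <> 0) by (intros H; apply RtoC_inj in H; lra).
  set (p := Cexp (2 * PI * Ci * tau / 5)).
  assert (Hp5 : p ^ 5 = q).
  { unfold q. replace (2 * PI * Ci * tau) with (2 * PI * Ci * tau / 5 + (2 * PI * Ci * tau / 5
      + (2 * PI * Ci * tau / 5 + (2 * PI * Ci * tau / 5 + 2 * PI * Ci * tau / 5))))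
      by (field; exact H5n).
    rewrite !Cexp_plus. fold p. ring. }
  assert (Hq51 : (Cmod (q ^ 5) < 1)%R) by now apply Cmod_pow_lt_1.
  destruct (prodlim_block (q ^ 5) 1 2 Hq51) as [a [Ha0 Ha]].
  destruct (prodlim_block (q ^ 5) 0 3 Hq51) as [c [Hc0 Hc]].
  destruct (prodlim_rr_factor q Hq1) as [r [Hr0 Hr]].
  destruct (prodlim_rr_factor (q ^ 5) Hq51) as [s [Hs0 Hs]].
  fold (rr_den (q ^ 5)) in Ha. fold (rr_num (q ^ 5)) in Hc.
  assert (Hu : u = p * r).
  { unfold u, rr. fold q p. f_equal. apply Clim_limC.
    eapply limC_ext; [intros n; symmetry; apply Cprod_cprod | exact Hr]. }
  assert (Ht : t = q * s).
  { unfold t, rr. rewrite H5.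
    replace (2 * PI * Ci * (5 * tau) / 5) with (2 * PI * Ci * tau) by (field; exact H5n).
    fold q. f_equal. apply Clim_limC.
    eapply limC_ext; [intros n; symmetry; apply Cprod_cprod | exact Hs]. }
  assert (Hta : t * a = q * c).
  { rewrite <- (rr_block _ _ _ _ Hq51 Ha Hc Hs), Ht. ring. }
  assert (Hp0 : p <> 0) by apply Cexp_neq_0.
  assert (Hlin : forall x y, cyclotomic5 x -> cyclotomic5 y \/ y = 1 ->
    a + (x ^ 2 + x ^ 3) * (y * (q * c)) <> 0).
  { intros x y Hx Hy.
    assert (Hy5 : y ^ 5 = 1) by (destruct Hy as [Hy| ->]; [now apply cyclotomic5_pow5 | ring]).
    assert (Hy1 : (Cmod y <= 1)%R)
      by (destruct Hy as [Hy| ->]; [now apply cyclotomic5_Cmod | rewrite Cmod_1; lra]).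
    assert (Hyq : (Cmod (y * q) < 1)%R).
    { rewrite Cmod_mult. pose proof (Cmod_ge_0 y). pose proof (Cmod_ge_0 q). nra. }
    assert (Hyq5 : (y * q) ^ 5 = q ^ 5) by (rewrite Cpow_mult_l, Hy5; ring).
    destruct (prodlim_theta_factor x (y * q) (cyclotomic5_Cmod x Hx) Hyq) as [m [Hm0 Hm]].
    replace (y * (q * c)) with (y * q * c) by ring.
    rewrite (prodlim_unique _ _ m (prodlim_theta_linear x (y * q) a c Hx
      ltac:(destruct Hy as [Hy| ->]; [apply Cmult_neq_0; [now apply cyclotomic5_neq_0 | exact Hq]
        | now rewrite Cmult_1_l]) Hyq
      ltac:(now rewrite Hyq5) ltac:(now rewrite Hyq5)) Hm).
    exact Hm0. }
  pose proof (cyclotomic5_pow4 z Hz) as H4. pose proof (cyclotomic5_pow5 z Hz) as Hz5.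
  assert (Hzk : forall k, (k = 2 \/ k = 3 \/ k = 4)%nat -> cyclotomic5 (z ^ k))
    by (intros; now apply cyclotomic5_pow).
  rewrite <- Hta in Hlin.
  repeat split.
  - rewrite Hu. now apply Cmult_neq_0.
  - rewrite Ht. now apply Cmult_neq_0.
  (* 1 - t - t^2 is the product of 1 + (z^2 + z^3) t and 1 + (z + z^4) t. *)
  - intros H. apply (Cmult_neq_0 _ _ (Hlin z 1 Hz (or_intror eq_refl))
      (Hlin (z ^ 2) 1 (Hzk 2%nat ltac:(auto)) (or_intror eq_refl))).
    transitivity (a ^ 2 * (1 - t - t ^ 2)); [ring [Hz5 H4] | rewrite H; ring].
  - intros H.
    apply (Cmult_neq_0 _ _
      (Cmult_neq_0 _ _ (Hlin z (z ^ 2) Hz (or_introl (Hzk 2%nat ltac:(auto))))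
        (Hlin z (z ^ 3) Hz (or_introl (Hzk 3%nat ltac:(auto)))))
      (Cmult_neq_0 _ _ (Hlin (z ^ 2) z (Hzk 2%nat ltac:(auto)) (or_introl Hz))
        (Hlin (z ^ 2) (z ^ 4) (Hzk 2%nat ltac:(auto)) (or_introl (Hzk 4%nat ltac:(auto)))))).
    transitivity (a ^ 4 * quartic_den t 1); [unfold quartic_den; ring [Hz5 H4] | rewrite H; ring].
  - apply Cmult_cancel_l with (a ^ 4); [now apply Cpow_nz|].
    (* The prefactors are p with p^5 = q in u and q in t, so one factor q completes both r^5 to u^5
       and s to t. *)
    transitivity (q * (r ^ 5 * quartic_den (q * c) a)).
    + rewrite Hu, <- Hta, <- Hp5. unfold quartic_den. ring.
    + rewrite (prodlim_quintic z q a c r s) by auto.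
      rewrite <- Hta. unfold quartic_num. rewrite Ht. ring.
Qed.

(** * Points of order 5 on a Weierstrass curve *)

(** [div2], [div2_sq] and [div3] are the division polynomials psi_2, psi_2^2 and psi_3 of a general
    Weierstrass equation, written out in the usual b_2, b_4, b_6, b_8. *)
Definition div2 (E : weierstrass) (x y : C) : C := 2 * y + a1 E * x + a3 E.

Definition div2_sq (E : weierstrass) (x : C) : C :=
  4 * x ^ 3 + (a1 E ^ 2 + 4 * a2 E) * x ^ 2 + 2 * (2 * a4 E + a1 E * a3 E) * x
  + (a3 E ^ 2 + 4 * a6 E).

Definition div2_sq_half_deriv (E : weierstrass) (x : C) : C :=
  6 * x ^ 2 + (a1 E ^ 2 + 4 * a2 E) * x + (2 * a4 E + a1 E * a3 E).

Definition div3 (E : weierstrass) (x : C) : C :=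
  3 * x ^ 4 + (a1 E ^ 2 + 4 * a2 E) * x ^ 3 + 3 * (2 * a4 E + a1 E * a3 E) * x ^ 2
  + 3 * (a3 E ^ 2 + 4 * a6 E) * x
  + (a1 E ^ 2 * a6 E + 4 * a2 E * a6 E - a1 E * a3 E * a4 E + a2 E * a3 E ^ 2 - a4 E ^ 2).

(** The negative of the fifth division polynomial. *)
Definition div5 (E : weierstrass) (x : C) : C :=
  div3 E x ^ 3 - div2_sq_half_deriv E x * div3 E x * div2_sq E x ^ 2 + div2_sq E x ^ 4.

Definition tangent (E : weierstrass) (x y : C) : C :=
  (3 * x ^ 2 + 2 * a2 E * x + a4 E - a1 E * y) / div2 E x y.

Lemma Csub_neq_0 (x y : C) : x <> y -> y - x <> 0.
Proof. intros H H0. apply H. replace y with (y - x + x) by ring. rewrite H0. ring. Qed.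

Lemma add_pt_chord (E : weierstrass) (x1 y1 x2 y2 : C) : x1 <> x2 ->
  add_pt E (Affine x1 y1) (Affine x2 y2) = chord_pt E ((y2 - y1) / (x2 - x1)) x1 y1 x2.
Proof. intros H. simpl. destruct (Ceq_dec x1 x2); [contradiction | reflexivity]. Qed.

Lemma add_pt_opp (E : weierstrass) (x1 y1 y2 : C) : y1 + y2 + a1 E * x1 + a3 E = 0 ->
  add_pt E (Affine x1 y1) (Affine x1 y2) = Infinity.
Proof.
  intros H. simpl. destruct (Ceq_dec x1 x1); [|contradiction].
  destruct (Ceq_dec _ 0); [reflexivity | contradiction].
Qed.

Lemma add_pt_tangent (E : weierstrass) (x y y2 : C) : y + y2 + a1 E * x + a3 E <> 0 ->
  add_pt E (Affine x y) (Affine x y2) = chord_pt E (tangent E x y) x y x.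
Proof.
  intros H. simpl. destruct (Ceq_dec x x); [|contradiction].
  destruct (Ceq_dec _ 0); [contradiction | reflexivity].
Qed.

Lemma chord_pt_affine (E : weierstrass) (l x1 y1 x2 : C) :
  exists x y, chord_pt E l x1 y1 x2 = Affine x y /\
    x = l ^ 2 + a1 E * l - a2 E - x1 - x2 /\ y = - (l * (x - x1) + y1) - a1 E * x - a3 E.
Proof. do 2 eexists. split; [reflexivity | split; reflexivity]. Qed.

Lemma div2_square (E : weierstrass) (x y : C) :
  on_curve E (Affine x y) -> div2 E x y ^ 2 = div2_sq E x.
Proof.
  unfold on_curve. intros H. unfold div2, div2_sq.
  transitivity (4 * (y ^ 2 + a1 E * x * y + a3 E * y) + (a1 E * x + a3 E) ^ 2); [ring|].
  rewrite H. ring.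
Qed.

(* 2P lies at x-distance -div3/div2^2 from P. *)
Lemma double_sub_x (E : weierstrass) (x y : C) :
  on_curve E (Affine x y) -> div2 E x y <> 0 ->
  (tangent E x y ^ 2 + a1 E * tangent E x y - a2 E - x - x - x) * div2 E x y ^ 2 = - div3 E x.
Proof.
  intros H Hw. pose proof (div2_square E x y H) as H2. unfold tangent.
  set (w := div2 E x y) in *. set (n := 3 * x ^ 2 + 2 * a2 E * x + a4 E - a1 E * y).
  transitivity (n ^ 2 + a1 E * n * w - (a2 E + 3 * x) * w ^ 2); [field; exact Hw|].
  rewrite H2. unfold n, w, div2, div2_sq, div3. unfold on_curve in H.
  transitivity (9 * x ^ 4 + 12 * a2 E * x ^ 3 + (4 * a2 E ^ 2 + 6 * a4 E) * x ^ 2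
    + 4 * a2 E * a4 E * x + a4 E ^ 2 + a1 E * (3 * x ^ 2 + 2 * a2 E * x + a4 E) * (a1 E * x + a3 E)
    - a1 E ^ 2 * (y ^ 2 + a1 E * x * y + a3 E * y)
    - (a2 E + 3 * x) * (4 * x ^ 3 + (a1 E ^ 2 + 4 * a2 E) * x ^ 2
      + 2 * (2 * a4 E + a1 E * a3 E) * x + (a3 E ^ 2 + 4 * a6 E))); [ring|].
  rewrite H. ring.
Qed.

(** Implicit differentiation of w^2 = [div2_sq]: along the tangent line w = [div2] has slope 2 l +
    a1. *)
Lemma tangent_div2 (E : weierstrass) (x y : C) :
  div2 E x y <> 0 ->
  (2 * tangent E x y + a1 E) * div2 E x y = div2_sq_half_deriv E x.
Proof.
  intros Hw. unfold tangent. set (w := div2 E x y) in *.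
  transitivity (2 * (3 * x ^ 2 + 2 * a2 E * x + a4 E - a1 E * y) + a1 E * w);
    [field; exact Hw|].
  unfold w, div2, div2_sq_half_deriv. ring.
Qed.

(* With w = div2, l the tangent slope and d = x(2P) - x(P), the equality
   x(3P) = x(2P) reads d^3 = (2l + a1) w d + w^2. *)
Lemma div5_cubic (E : weierstrass) (x y d : C) :
  on_curve E (Affine x y) -> div2 E x y <> 0 ->
  d = tangent E x y ^ 2 + a1 E * tangent E x y - a2 E - x - x - x ->
  (div5 E x = 0 <->
   d ^ 3 = (2 * tangent E x y + a1 E) * div2 E x y * d + div2 E x y ^ 2).
Proof.
  intros H Hw Hd. pose proof (double_sub_x E x y H Hw) as H3. rewrite <- Hd in H3.
  rewrite (tangent_div2 E x y Hw). unfold div5. rewrite <- (div2_square E x y H).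
  replace (div3 E x) with (- (d * div2 E x y ^ 2)) by (rewrite H3; ring).
  set (w := div2 E x y) in *. set (h := div2_sq_half_deriv E x).
  replace ((- (d * w ^ 2)) ^ 3 - h * - (d * w ^ 2) * (w ^ 2) ^ 2 + (w ^ 2) ^ 4)
    with (w ^ 6 * (h * d + w ^ 2 - d ^ 3)) by ring.
  split.
  - intros H0. destruct (Ceq_dec (h * d + w ^ 2 - d ^ 3) 0) as [H1|H1].
    + replace (d ^ 3) with (h * d + w ^ 2 - (h * d + w ^ 2 - d ^ 3)) by ring. rewrite H1. ring.
    + exfalso. apply (Cmult_neq_0 (w ^ 6) (h * d + w ^ 2 - d ^ 3)); auto using Cpow_nz.
  - intros ->. ring.
Qed.

(** Here (x2, y2) is 2P and k is the slope of the chord from P to 2P, so the left side of the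
    equivalence says that 3P and 2P have the same abscissa. *)
Lemma tripled_x (E : weierstrass) (x y d : C) :
  div2 E x y <> 0 -> d <> 0 ->
  let l := tangent E x y in
  d = l ^ 2 + a1 E * l - a2 E - x - x - x ->
  let x2 := x + d in
  let y2 := - (l * (x2 - x) + y) - a1 E * x2 - a3 E in
  let k := (y2 - y) / (x2 - x) in
  k = - l - a1 E - div2 E x y / d /\
  (k ^ 2 + a1 E * k - a2 E - x - x2 = x2 <->
   d ^ 3 = (2 * l + a1 E) * div2 E x y * d + div2 E x y ^ 2).
Proof.
  intros Hw Hd l Hdl x2 y2 k.
  assert (Hk : k = - l - a1 E - div2 E x y / d).
  { unfold k, y2, x2. replace (x + d - x) with d by ring. unfold div2. field. exact Hd. }
  split; [exact Hk|]. rewrite Hk. set (w := div2 E x y) in *.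
  assert (He : (- l - a1 E - w / d) ^ 2 + a1 E * (- l - a1 E - w / d) - a2 E - x - x2 - x2
    = ((2 * l + a1 E) * w * d + w ^ 2 - d ^ 3) / d ^ 2).
  { unfold x2. transitivity ((l ^ 2 + a1 E * l - a2 E - x - x - x) - d - d +
      ((2 * l + a1 E) * w * d + w ^ 2) / d ^ 2); [field; exact Hd|].
    rewrite <- Hdl. field. exact Hd. }
  assert (Hd2 : d ^ 2 <> 0) by now apply Cpow_nz.
  split; intros H.
  - rewrite H in He.
    assert (H0 : (2 * l + a1 E) * w * d + w ^ 2 - d ^ 3 = 0).
    { transitivity (((2 * l + a1 E) * w * d + w ^ 2 - d ^ 3) / d ^ 2 * d ^ 2);
        [field; exact Hd|]. rewrite <- He. ring. }
    replace (d ^ 3) with ((2 * l + a1 E) * w * d + w ^ 2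
      - ((2 * l + a1 E) * w * d + w ^ 2 - d ^ 3)) by ring. rewrite H0. ring.
  - rewrite H in He.
    transitivity (x2 + ((- l - a1 E - w / d) ^ 2 + a1 E * (- l - a1 E - w / d) - a2 E - x - x2 - x2));
      [ring|]. rewrite He. field. exact Hd.
Qed.

(** * Third intersection points of chords and tangents *)

Definition line_cubic (E : weierstrass) (l x1 y1 x : C) : C :=
  (l * (x - x1) + y1) ^ 2 + a1 E * x * (l * (x - x1) + y1) + a3 E * (l * (x - x1) + y1)
  - (x ^ 3 + a2 E * x ^ 2 + a4 E * x + a6 E).

Lemma on_curve_chord_pt (E : weierstrass) (l x1 y1 x2 : C) :
  line_cubic E l x1 y1 (l ^ 2 + a1 E * l - a2 E - x1 - x2) = 0 ->
  on_curve E (chord_pt E l x1 y1 x2).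
Proof.
  unfold chord_pt, opp_pt, on_curve. set (x := l ^ 2 + a1 E * l - a2 E - x1 - x2).
  unfold line_cubic. set (y := l * (x - x1) + y1). intros H.
  transitivity ((y ^ 2 + a1 E * x * y + a3 E * y - (x ^ 3 + a2 E * x ^ 2 + a4 E * x + a6 E))
    + (x ^ 3 + a2 E * x ^ 2 + a4 E * x + a6 E)); [ring | rewrite H; ring].
Qed.

Lemma on_curve_chord (E : weierstrass) (x1 y1 x2 y2 : C) :
  on_curve E (Affine x1 y1) -> on_curve E (Affine x2 y2) -> x1 <> x2 ->
  on_curve E (chord_pt E ((y2 - y1) / (x2 - x1)) x1 y1 x2).
Proof.
  intros H1 H2 Hx. pose proof (Csub_neq_0 _ _ Hx) as Hd.
  apply on_curve_chord_pt. set (l := (y2 - y1) / (x2 - x1)).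
  assert (Hy : y2 = y1 + l * (x2 - x1)) by (unfold l; field; exact Hd).
  set (x3 := l ^ 2 + a1 E * l - a2 E - x1 - x2).
  apply Cmult_cancel_l with (x2 - x1); [exact Hd|].
  unfold on_curve in H1, H2.
  (* Up to its linear interpolation at x1 and x2, the cubic on the line is -(x - x1)(x - x2)(x -
     x3), which vanishes at x3. *)
  transitivity ((y1 ^ 2 + a1 E * x1 * y1 + a3 E * y1 - (x1 ^ 3 + a2 E * x1 ^ 2 + a4 E * x1 + a6 E))
      * (x2 - x3)
    + (y2 ^ 2 + a1 E * x2 * y2 + a3 E * y2 - (x2 ^ 3 + a2 E * x2 ^ 2 + a4 E * x2 + a6 E))
      * (x3 - x1)); [|rewrite H1, H2; ring].
  rewrite Hy. unfold line_cubic, x3. ring.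
Qed.

Lemma on_curve_tangent (E : weierstrass) (x y : C) :
  on_curve E (Affine x y) -> div2 E x y <> 0 ->
  on_curve E (chord_pt E (tangent E x y) x y x).
Proof.
  intros H Hw. apply on_curve_chord_pt. set (l := tangent E x y).
  assert (Hl : l * div2 E x y = 3 * x ^ 2 + 2 * a2 E * x + a4 E - a1 E * y)
    by (unfold l, tangent; field; exact Hw).
  set (x3 := l ^ 2 + a1 E * l - a2 E - x - x). unfold on_curve in H.
  (* The case of a double root: interpolation becomes value plus derivative times x3 - x. *)
  transitivity ((y ^ 2 + a1 E * x * y + a3 E * y - (x ^ 3 + a2 E * x ^ 2 + a4 E * x + a6 E))
    + (l * div2 E x y - (3 * x ^ 2 + 2 * a2 E * x + a4 E - a1 E * y)) * (x3 - x));
    [|rewrite H, Hl; ring].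
  unfold line_cubic, div2, x3. ring.
Qed.

(** The third intersection has abscissa x again, so x is a double root of the cubic on the line. *)
Lemma chord_returning_is_tangent (E : weierstrass) (x y x3 y3 : C) :
  on_curve E (Affine x y) -> on_curve E (Affine x3 y3) -> x <> x3 -> div2 E x y <> 0 ->
  let l := (y3 - y) / (x3 - x) in
  l ^ 2 + a1 E * l - a2 E - x - x3 = x -> l = tangent E x y.
Proof.
  intros H H3 Hx Hw l Hl. pose proof (Csub_neq_0 _ _ Hx) as Hd.
  assert (Hy : y3 = y + l * (x3 - x)) by (unfold l; field; exact Hd).
  apply Cmult_cancel_l with (div2 E x y); [exact Hw|].
  transitivity (3 * x ^ 2 + 2 * a2 E * x + a4 E - a1 E * y);
    [|unfold tangent; field; exact Hw].
  apply Cmult_cancel_l with (x3 - x); [exact Hd|].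
  unfold on_curve in H, H3.
  transitivity ((x3 - x) * (3 * x ^ 2 + 2 * a2 E * x + a4 E - a1 E * y)
    + (y3 ^ 2 + a1 E * x3 * y3 + a3 E * y3 - (x3 ^ 3 + a2 E * x3 ^ 2 + a4 E * x3 + a6 E))
    - (y ^ 2 + a1 E * x * y + a3 E * y - (x ^ 3 + a2 E * x ^ 2 + a4 E * x + a6 E))
    - (x3 - x) ^ 2 * (l ^ 2 + a1 E * l - a2 E - x - x3 - x));
    [|rewrite H, H3, Hl; ring].
  rewrite Hy. unfold div2. ring.
Qed.

(** * Order 5 and the fifth division polynomial *)

Lemma mul_pt_S (E : weierstrass) (n : nat) (P : point) :
  mul_pt E (S n) P = add_pt E P (mul_pt E n P).
Proof. reflexivity. Qed.

(** 5P = O forces 4P to have the abscissa of P. The chord from P to 3P then returns to P, so it is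
    the tangent at P and 3P has the abscissa of 2P. Every degenerate branch of [add_pt] on the way
    contradicts 5P = O. *)
Lemma torsion5_div5 (E : weierstrass) (x y : C) :
  on_curve E (Affine x y) -> mul_pt E 5 (Affine x y) = Infinity -> div5 E x = 0.
Proof.
  intros H H5. set (P := Affine x y) in *.
  assert (HPI : add_pt E P Infinity = P) by reflexivity.
  rewrite !mul_pt_S in H5. simpl mul_pt in H5. rewrite HPI in H5.
  assert (Hw : div2 E x y <> 0).
  { intros Hw.
    assert (HPP : add_pt E P P = Infinity)
      by (apply add_pt_opp; rewrite <- Hw; unfold div2; ring).
    rewrite !HPP, !HPI, HPP in H5. discriminate. }
  set (l := tangent E x y).
  assert (HT : forall y', y + y' + a1 E * x + a3 E <> 0 ->
    add_pt E P (Affine x y') = chord_pt E l x y x) by (intros; now apply add_pt_tangent).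
  assert (HP2 : add_pt E P P = chord_pt E l x y x).
  { apply HT. intros H0. apply Hw. rewrite <- H0. unfold div2. ring. }
  rewrite HP2 in H5. pose proof (on_curve_tangent E x y H Hw) as Hc2. fold l in Hc2.
  destruct (chord_pt_affine E l x y x) as (x2 & y2 & E2 & Hx2 & Hy2).
  rewrite E2 in *.
  destruct (Ceq_dec x x2) as [<-|Hx].
  { exfalso. destruct (Ceq_dec (y + y2 + a1 E * x + a3 E) 0) as [H0|H0].
    - assert (HO : add_pt E P (Affine x y2) = Infinity) by now apply add_pt_opp.
      rewrite HO, HPI, HP2 in H5. discriminate.
    - rewrite !(HT y2 H0) in H5. discriminate. }
  assert (HC2 : add_pt E P (Affine x2 y2) = chord_pt E ((y2 - y) / (x2 - x)) x y x2)
    by now apply add_pt_chord.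
  rewrite HC2 in H5.
  pose proof (on_curve_chord E x y x2 y2 H Hc2 Hx) as Hc3.
  set (k := (y2 - y) / (x2 - x)) in *.
  destruct (chord_pt_affine E k x y x2) as (x3 & y3 & E3 & Hx3 & Hy3).
  rewrite E3 in *.
  destruct (Ceq_dec x x3) as [<-|Hxx3].
  { exfalso. destruct (Ceq_dec (y + y3 + a1 E * x + a3 E) 0) as [H0|H0].
    - assert (HO : add_pt E P (Affine x y3) = Infinity) by now apply add_pt_opp.
      rewrite HO, HPI in H5. discriminate.
    - rewrite (HT y3 H0), HC2 in H5. discriminate. }
  assert (HC3 : add_pt E P (Affine x3 y3) = chord_pt E ((y3 - y) / (x3 - x)) x y x3)
    by now apply add_pt_chord.
  rewrite HC3 in H5.
  set (m := (y3 - y) / (x3 - x)) in *.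
  destruct (chord_pt_affine E m x y x3) as (x4 & y4 & E4 & Hx4 & Hy4).
  rewrite E4 in H5.
  destruct (Ceq_dec x x4) as [<-|Hxx4].
  2:{ assert (HC4 : add_pt E P (Affine x4 y4) = chord_pt E ((y4 - y) / (x4 - x)) x y x4)
        by now apply add_pt_chord.
      rewrite HC4 in H5. discriminate. }
  assert (Hml : m = l) by (apply (chord_returning_is_tangent E x y x3 y3); auto).
  assert (H32 : x3 = x2).
  { rewrite Hx2, <- Hml.
    replace (m ^ 2 + a1 E * m - a2 E - x - x)
      with (m ^ 2 + a1 E * m - a2 E - x - x3 + x3 - x) by ring.
    rewrite <- Hx4. ring. }
  pose proof (Csub_neq_0 _ _ Hx) as Hd.
  assert (Hdl : x2 - x = l ^ 2 + a1 E * l - a2 E - x - x - x) by (rewrite Hx2; ring).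
  apply (div5_cubic E x y (x2 - x) H Hw Hdl).
  apply (tripled_x E x y (x2 - x) Hw Hd Hdl).
  replace (x + (x2 - x)) with x2 by ring. fold l. rewrite <- Hy2. fold k.
  rewrite <- H32 at 2. rewrite Hx3. ring.
Qed.

(** The same chain backwards; the multiples from P to 4P come out affine, which makes the order
    exactly 5. *)
Lemma div5_order5 (E : weierstrass) (x y : C) :
  on_curve E (Affine x y) -> div2 E x y <> 0 -> div5 E x = 0 ->
  has_order E (Affine x y) 5.
Proof.
  intros H Hw H5. set (P := Affine x y). set (l := tangent E x y).
  destruct (chord_pt_affine E l x y x) as (x2 & y2 & E2 & Hx2 & Hy2).
  assert (Hdl : x2 - x = l ^ 2 + a1 E * l - a2 E - x - x - x) by (rewrite Hx2; ring).
  pose proof (proj1 (div5_cubic E x y (x2 - x) H Hw Hdl) H5) as Hcub.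
  assert (Hx : x <> x2).
  { intros <-. apply Hw. replace (x - x) with (RtoC 0) in Hcub by ring.
    destruct (Ceq_dec (div2 E x y) 0) as [|Hn]; [assumption|].
    exfalso. apply (Cpow_nz _ 2 Hn).
    replace (div2 E x y ^ 2) with ((2 * tangent E x y + a1 E) * div2 E x y * 0 + div2 E x y ^ 2)
      by ring. rewrite <- Hcub. ring. }
  pose proof (Csub_neq_0 _ _ Hx) as Hd.
  destruct (tripled_x E x y (x2 - x) Hw Hd Hdl) as [Hk1 Hk2].
  apply Hk2 in Hcub. clear Hk2. fold l in Hk1, Hcub.
  replace (x + (x2 - x)) with x2 in Hk1, Hcub by ring. rewrite <- Hy2 in Hk1, Hcub.
  set (k := (y2 - y) / (x2 - x)) in *.
  assert (P2 : mul_pt E 2 P = Affine x2 y2).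
  { transitivity (add_pt E (Affine x y) (Affine x y)); [reflexivity|].
    rewrite add_pt_tangent; [exact E2|]. intros H0. apply Hw. rewrite <- H0. unfold div2. ring. }
  destruct (chord_pt_affine E k x y x2) as (x3 & y3 & E3 & Hx3 & Hy3).
  assert (P3 : mul_pt E 3 P = Affine x3 y3).
  { rewrite mul_pt_S, P2. unfold P. rewrite add_pt_chord by exact Hx. exact E3. }
  assert (Hx32 : x3 = x2) by (rewrite Hx3; exact Hcub). clear Hx3. subst x3.
  set (m := (y3 - y) / (x2 - x)).
  (* The chord from P to 3P has the slope of the tangent at P, so it meets the curve at P again and
     4P = -P. *)
  assert (Hm : m = l).
  { unfold m. rewrite Hy3, Hk1. unfold div2. field. exact Hd. }
  destruct (chord_pt_affine E m x y x2) as (x4 & y4 & E4 & Hx4 & Hy4).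
  assert (P4 : mul_pt E 4 P = Affine x4 y4).
  { rewrite mul_pt_S, P3. unfold P. rewrite add_pt_chord by exact Hx. exact E4. }
  assert (Hx4x : x4 = x).
  { rewrite Hx4, Hm. rewrite Hx2. ring. }
  split; [lia|]. split.
  - rewrite mul_pt_S, P4. unfold P. rewrite Hx4x in Hy4 |- *. apply add_pt_opp.
    rewrite Hy4. ring.
  - intros [|[|[|[|[|n]]]]] Hn; try lia; rewrite ?P2, ?P3, ?P4; discriminate.
Qed.

(** * Parametrization of the 5-torsion of E_5(b) *)

Lemma RtoC_neq_0 (x : R) : x <> 0%R -> RtoC x <> 0.
Proof. intros H H0. apply H. now apply RtoC_inj. Qed.

Lemma C5_neq_0 : RtoC 5 <> 0.
Proof. apply RtoC_neq_0. lra. Qed.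

Lemma Cmult_integral (x y : C) : x * y = 0 -> x = 0 \/ y = 0.
Proof.
  intros H. destruct (Ceq_dec x 0) as [|Hx]; [now left|].
  destruct (Ceq_dec y 0) as [|Hy]; [now right|].
  exfalso. now apply (Cmult_neq_0 x y).
Qed.

Lemma Cmult_nz_l (x y : C) : x * y <> 0 -> x <> 0.
Proof. intros H ->. apply H. ring. Qed.

Lemma Cmult_nz_r (x y : C) : x * y <> 0 -> y <> 0.
Proof. intros H ->. apply H. ring. Qed.

(** For b <> 0 these are the parameters over b outside the twelve cusps: infinity, 0, the four roots
    of each quartic and the two roots of 1 - s - s^2. *)
Definition good_param (b s : C) : Prop :=
  quartic_den s 1 <> 0 /\ 1 - s - s ^ 2 <> 0 /\ b * quartic_den s 1 = quartic_num s 1 * s.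

(* For e = w + 1/w in {eps, -1/eps}: 2e + 1 = +-sqrt 5, so that (e - 2)/5 is the
   constant -eps/sqrt 5 or its conjugate, and s^2 + s + e^2 has the roots w + w^3
   and w^2 + w^4.  The point with w^4 in place of w is the opposite point. *)
Definition x_param (w s : C) : C :=
  (w + w ^ 4 - 2) / 5 * ((s - 1 - w) * (s - 1 - w ^ 2) * (s - 1 - w ^ 3) * (s - 1 - w ^ 4)
    / ((s - w - w ^ 3) * (s - w ^ 2 - w ^ 4))).

(** The two ordinates over x multiply to -x^2 (x + b), whose zeros and poles all lie at cusps; its
    divisor is the sum of that of [y_param w] and its image under w -> w^4. *)
Definition y_param (w s : C) : C :=
  (1 - w + w ^ 2 - w ^ 3) / 5 *
  ((s - 1 - w) ^ 2 * (s - 1 - w ^ 2) ^ 2 * (s - 1 - w ^ 3) * (s - 1 - w ^ 4) ^ 2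
   / ((s - w - w ^ 3) * (s - w ^ 2 - w ^ 4) ^ 2 * (s - w - w ^ 2))).

Lemma quartic_num_factor (w s : C) : cyclotomic5 w ->
  quartic_num s 1 = (s - 1 - w) * (s - 1 - w ^ 2) * (s - 1 - w ^ 3) * (s - 1 - w ^ 4).
Proof.
  intros Hw. unfold quartic_num. ring [(cyclotomic5_pow5 w Hw) (cyclotomic5_pow4 w Hw)].
Qed.

Lemma quartic_den_factor (w s : C) : cyclotomic5 w ->
  quartic_den s 1 = (s - w - w ^ 3) * (s - w ^ 2 - w ^ 4) *
    ((s - w - w ^ 2) * (s - w ^ 3 - w ^ 4)).
Proof.
  intros Hw. unfold quartic_den. ring [(cyclotomic5_pow5 w Hw) (cyclotomic5_pow4 w Hw)].
Qed.

Lemma good_param_factors (b s w : C) : cyclotomic5 w -> b <> 0 -> good_param b s ->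
  s <> 0 /\ (s - 1 - w <> 0 /\ s - 1 - w ^ 2 <> 0 /\ s - 1 - w ^ 3 <> 0 /\ s - 1 - w ^ 4 <> 0) /\
  (s - w - w ^ 3 <> 0 /\ s - w ^ 2 - w ^ 4 <> 0 /\ s - w - w ^ 2 <> 0 /\ s - w ^ 3 - w ^ 4 <> 0).
Proof.
  intros Hw Hb (HD & _ & Hbs).
  assert (Hn : quartic_num s 1 * s <> 0) by (rewrite <- Hbs; now apply Cmult_neq_0).
  pose proof (Cmult_nz_r _ _ Hn) as Hs. apply Cmult_nz_l in Hn.
  rewrite (quartic_num_factor w s Hw) in Hn. rewrite (quartic_den_factor w s Hw) in HD.
  pose proof (Cmult_nz_r _ _ Hn). apply Cmult_nz_l in Hn.
  pose proof (Cmult_nz_r _ _ Hn). apply Cmult_nz_l in Hn.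
  pose proof (Cmult_nz_r _ _ Hn). apply Cmult_nz_l in Hn.
  pose proof (Cmult_nz_r _ _ HD) as HD'. apply Cmult_nz_l in HD.
  pose proof (Cmult_nz_r _ _ HD). apply Cmult_nz_l in HD.
  pose proof (Cmult_nz_r _ _ HD'). apply Cmult_nz_l in HD'. tauto.
Qed.

Lemma good_param_b (b s w : C) : cyclotomic5 w -> good_param b s ->
  b = s * ((s - 1 - w) * (s - 1 - w ^ 2) * (s - 1 - w ^ 3) * (s - 1 - w ^ 4))
    / ((s - w - w ^ 3) * (s - w ^ 2 - w ^ 4) * ((s - w - w ^ 2) * (s - w ^ 3 - w ^ 4))).
Proof.
  intros Hw (HD & _ & Hbs).
  rewrite <- (quartic_num_factor w s Hw), <- (quartic_den_factor w s Hw).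
  apply Cmult_cancel_l with (quartic_den s 1); [exact HD|].
  rewrite Cmult_comm, Hbs. field. exact HD.
Qed.

Lemma x_param_conj (w s : C) : cyclotomic5 w -> x_param (w ^ 4) s = x_param w s.
Proof.
  intros Hw. unfold x_param. pose proof (cyclotomic5_pow5 w Hw) as H5.
  replace ((w ^ 4) ^ 2) with (w ^ 3) by ring [H5].
  replace ((w ^ 4) ^ 3) with (w ^ 2) by ring [H5].
  replace ((w ^ 4) ^ 4) with w by ring [H5].
  rewrite (Cplus_comm (w ^ 4) w). f_equal. f_equal; ring.
Qed.

Lemma y_param_conj (w s : C) : cyclotomic5 w ->
  y_param (w ^ 4) s = (1 - w ^ 4 + w ^ 3 - w ^ 2) / 5 *
  ((s - 1 - w ^ 4) ^ 2 * (s - 1 - w ^ 3) ^ 2 * (s - 1 - w ^ 2) * (s - 1 - w) ^ 2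
   / ((s - w ^ 4 - w ^ 2) * (s - w ^ 3 - w) ^ 2 * (s - w ^ 4 - w ^ 3))).
Proof.
  intros Hw. unfold y_param. pose proof (cyclotomic5_pow5 w Hw) as H5.
  replace ((w ^ 4) ^ 2) with (w ^ 3) by ring [H5].
  replace ((w ^ 4) ^ 3) with (w ^ 2) by ring [H5].
  replace ((w ^ 4) ^ 4) with w by ring [H5]. reflexivity.
Qed.

(** With [y_param_prod], Vieta's formulas for the curve equation as a quadratic in Y. *)
Lemma y_param_sum (b s w : C) : cyclotomic5 w -> b <> 0 -> good_param b s ->
  y_param w s + y_param (w ^ 4) s = - ((1 + b) * x_param w s + b).
Proof.
  intros Hw Hb Hs.
  destruct (good_param_factors b s w Hw Hb Hs) as (_ & _ & H1 & H2 & H3 & H4).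
  rewrite (y_param_conj w s Hw), (good_param_b b s w Hw Hs).
  replace (s - w ^ 4 - w ^ 2) with (s - w ^ 2 - w ^ 4) by ring.
  replace (s - w ^ 3 - w) with (s - w - w ^ 3) by ring.
  replace (s - w ^ 4 - w ^ 3) with (s - w ^ 3 - w ^ 4) by ring.
  unfold x_param, y_param. pose proof C5_neq_0 as H5n.
  set (d1 := s - w - w ^ 3) in *. set (d2 := s - w ^ 2 - w ^ 4) in *.
  set (d3 := s - w - w ^ 2) in *. set (d4 := s - w ^ 3 - w ^ 4) in *.
  apply Cmult_cancel_l with (5 * (d1 ^ 2 * d2 ^ 2 * (d3 * d4)));
    [repeat apply Cmult_neq_0; auto using C1_nz|].
  set (n := (s - 1 - w) * (s - 1 - w ^ 2) * (s - 1 - w ^ 3) * (s - 1 - w ^ 4)).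
  transitivity (n * ((1 - w + w ^ 2 - w ^ 3) * ((s - 1 - w) * (s - 1 - w ^ 2) * (s - 1 - w ^ 4)) * d1 * d4
    + (1 - w ^ 4 + w ^ 3 - w ^ 2) * ((s - 1 - w ^ 4) * (s - 1 - w ^ 3) * (s - 1 - w)) * d2 * d3)).
  { unfold n. field. repeat split; auto. }
  transitivity (n * (- ((w + w ^ 4 - 2) * (d1 * d2 * d3 * d4 + s * n) + 5 * s * d1 * d2))).
  2:{ unfold n. field. repeat split; auto. }
  f_equal. unfold n, d1, d2, d3, d4. clear - Hw.
  ring [(cyclotomic5_pow5 w Hw) (cyclotomic5_pow4 w Hw)].
Qed.

Lemma y_param_prod (b s w : C) : cyclotomic5 w -> b <> 0 -> good_param b s ->
  y_param w s * y_param (w ^ 4) s = - (x_param w s ^ 3 + b * x_param w s ^ 2).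
Proof.
  intros Hw Hb Hs.
  destruct (good_param_factors b s w Hw Hb Hs) as (_ & _ & H1 & H2 & H3 & H4).
  rewrite (y_param_conj w s Hw), (good_param_b b s w Hw Hs).
  replace (s - w ^ 4 - w ^ 2) with (s - w ^ 2 - w ^ 4) by ring.
  replace (s - w ^ 3 - w) with (s - w - w ^ 3) by ring.
  replace (s - w ^ 4 - w ^ 3) with (s - w ^ 3 - w ^ 4) by ring.
  unfold x_param, y_param. pose proof C5_neq_0 as H5n.
  set (d1 := s - w - w ^ 3) in *. set (d2 := s - w ^ 2 - w ^ 4) in *.
  set (d3 := s - w - w ^ 2) in *. set (d4 := s - w ^ 3 - w ^ 4) in *.
  apply Cmult_cancel_l with (125 * (d1 ^ 3 * d2 ^ 3 * (d3 * d4)));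
    [repeat apply Cmult_neq_0; auto using C1_nz; apply RtoC_neq_0; lra|].
  set (n := (s - 1 - w) * (s - 1 - w ^ 2) * (s - 1 - w ^ 3) * (s - 1 - w ^ 4)).
  transitivity (n ^ 3 * (5 * ((1 - w + w ^ 2 - w ^ 3) * (1 - w ^ 4 + w ^ 3 - w ^ 2))
    * ((s - 1 - w) * (s - 1 - w ^ 4)))).
  { unfold n. field. repeat split; auto. }
  transitivity (n ^ 3 * (- ((w + w ^ 4 - 2) ^ 2 * ((w + w ^ 4 - 2) * d3 * d4 + 5 * s)))).
  2:{ unfold n. field. repeat split; auto. }
  f_equal. unfold d3, d4. clear - Hw.
  ring [(cyclotomic5_pow5 w Hw) (cyclotomic5_pow4 w Hw)].
Qed.

(** Equal ordinates would make P a 2-torsion point. After cancelling common factors their difference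
    is a cubic in s whose roots are already roots of 1 - s - s^2. *)
Lemma y_param_distinct (b s w : C) : cyclotomic5 w -> b <> 0 -> good_param b s ->
  y_param w s <> y_param (w ^ 4) s.
Proof.
  intros Hw Hb Hs.
  destruct (good_param_factors b s w Hw Hb Hs) as (_ & (H1 & H2 & H3 & H4) & K1 & K2 & K3 & K4).
  destruct Hs as (_ & Hs & _).
  pose proof (cyclotomic5_pow5 w Hw) as H5. pose proof (cyclotomic5_pow4 w Hw) as Hw4.
  rewrite (y_param_conj w s Hw).
  replace (s - w ^ 4 - w ^ 2) with (s - w ^ 2 - w ^ 4) by ring.
  replace (s - w ^ 3 - w) with (s - w - w ^ 3) by ring.
  replace (s - w ^ 4 - w ^ 3) with (s - w ^ 3 - w ^ 4) by ring.
  unfold y_param. pose proof C5_neq_0 as H5n. intros He. clear Hb b.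
  set (d1 := s - w - w ^ 3) in *. set (d2 := s - w ^ 2 - w ^ 4) in *.
  set (d3 := s - w - w ^ 2) in *. set (d4 := s - w ^ 3 - w ^ 4) in *.
  set (n1 := s - 1 - w) in *. set (n2 := s - 1 - w ^ 2) in *.
  set (n3 := s - 1 - w ^ 3) in *. set (n4 := s - 1 - w ^ 4) in *.
  assert (Hlin : (1 - w + w ^ 2 - w ^ 3) * (n2 * d1 * d4)
    = (1 - w ^ 4 + w ^ 3 - w ^ 2) * (n3 * d2 * d3)).
  { apply Cmult_cancel_l with (n1 ^ 2 * n2 * n3 * n4 ^ 2);
      [repeat apply Cmult_neq_0; auto using C1_nz|].
    transitivity (5 * (d1 ^ 2 * d2 ^ 2 * d3 * d4) * ((1 - w + w ^ 2 - w ^ 3) / 5 *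
      (n1 ^ 2 * n2 ^ 2 * n3 * n4 ^ 2 / (d1 * d2 ^ 2 * d3)))); [field; repeat split; auto|].
    rewrite He. field. repeat split; auto. }
  (* The multiplier 4 + 8w + 7w^2 + w^3 turns the leading coefficient of the difference into -5. *)
  assert (H0 : (1 - s - s ^ 2) * (s - w ^ 2 - w ^ 3) * 5 = 0).
  { transitivity ((4 + 8 * w + 7 * w ^ 2 + w ^ 3) *
      ((1 - w + w ^ 2 - w ^ 3) * (n2 * d1 * d4) - (1 - w ^ 4 + w ^ 3 - w ^ 2) * (n3 * d2 * d3)));
      [|rewrite Hlin; ring].
    unfold n2, n3, d1, d2, d3, d4. clear - H5 Hw4. ring [H5 Hw4]. }
  apply Cmult_integral in H0 as [H0|H0]; [|contradiction].
  apply Cmult_integral in H0 as [H0|H0]; [contradiction|].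
  apply Hs. transitivity (- ((s - w - w ^ 4) * (s - w ^ 2 - w ^ 3)));
    [clear - H5 Hw4; ring [H5 Hw4] | rewrite H0; ring].
Qed.

Lemma x_param_num_neq_0 (w : C) : cyclotomic5 w -> (w + w ^ 4 - 2) / 5 <> 0.
Proof.
  intros Hw. pose proof C5_neq_0. pose proof (cyclotomic5_neq_1 w Hw) as H1.
  replace (w + w ^ 4 - 2) with (w ^ 4 * (1 - w) ^ 2) by ring [(cyclotomic5_pow5 w Hw)].
  pose proof (cyclotomic5_neq_0 w Hw).
  intros Hz. apply (Cmult_neq_0 (w ^ 4) ((1 - w) ^ 2)); auto using Cpow_nz.
  transitivity (5 * (w ^ 4 * (1 - w) ^ 2 / 5)); [field; assumption | rewrite Hz; ring].
Qed.

(** 0 and -b are the abscissas of the affine points of the subgroup generated by (0,0). Like x, x +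
    b is a product of linear factors belonging to cusps. *)
Lemma x_param_neq (b s w : C) : cyclotomic5 w -> b <> 0 -> good_param b s ->
  x_param w s <> 0 /\ x_param w s + b <> 0.
Proof.
  intros Hw Hb Hs.
  destruct (good_param_factors b s w Hw Hb Hs) as (_ & (H1 & H2 & H3 & H4) & K1 & K2 & K3 & K4).
  pose proof (x_param_num_neq_0 w Hw) as Hc. pose proof C5_neq_0 as H5n.
  assert (Hinv : forall z : C, z <> 0 -> / z <> 0).
  { intros z Hz H0. apply C1_nz. rewrite <- (Cinv_r z Hz), H0. ring. }
  rewrite (good_param_b b s w Hw Hs). unfold x_param. split.
  - apply Cmult_neq_0; [exact Hc|]. unfold Cdiv.
    apply Cmult_neq_0; [|apply Hinv; now apply Cmult_neq_0].
    repeat apply Cmult_neq_0; auto.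
  - set (d1 := s - w - w ^ 3) in *. set (d2 := s - w ^ 2 - w ^ 4) in *.
    set (d3 := s - w - w ^ 2) in *. set (d4 := s - w ^ 3 - w ^ 4) in *.
    set (n := (s - 1 - w) * (s - 1 - w ^ 2) * (s - 1 - w ^ 3) * (s - 1 - w ^ 4)).
    replace ((w + w ^ 4 - 2) / 5 * (n / (d1 * d2)) + s * n / (d1 * d2 * (d3 * d4)))
      with ((w + w ^ 4 - 2) / 5 * (n * ((s - 1 - w) * (s - 1 - w ^ 4)) * / (d1 * d2 * d3 * d4))).
    + apply Cmult_neq_0; [exact Hc|].
      apply Cmult_neq_0; [|apply Hinv; repeat apply Cmult_neq_0; auto].
      unfold n. repeat apply Cmult_neq_0; auto.
    + transitivity (n / (5 * d1 * d2 * d3 * d4) * ((w + w ^ 4 - 2) * (d3 * d4) + 5 * s));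
        [|field; repeat split; auto].
      replace ((w + w ^ 4 - 2) * (d3 * d4) + 5 * s) with
        ((w + w ^ 4 - 2) * ((s - 1 - w) * (s - 1 - w ^ 4)));
        [field; repeat split; auto|].
      unfold d3, d4. clear - Hw. ring [(cyclotomic5_pow5 w Hw) (cyclotomic5_pow4 w Hw)].
Qed.

(** The quintic whose roots are the x-coordinates of +-P + <(0,0)>, where P is
    the point with parameters w, s and e = w + w^4, homogenized in b/d. *)
Definition quintic (e x b d : C) : C :=
  5 * x ^ 5 * d ^ 4
  + ((3 + e) * d ^ 2 + (7 - 11 * e) * b * d + (2 - e) * b ^ 2) * d ^ 2 * x ^ 4
  + ((11 + 2 * e) * b * d ^ 3 + (9 - 22 * e) * b ^ 2 * d ^ 2 - (1 + 2 * e) * b ^ 3 * d) * x ^ 3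
  + ((18 + e) * b ^ 2 * d ^ 2 + (12 - 11 * e) * b ^ 3 * d + (2 - e) * b ^ 4) * x ^ 2
  + (15 * b ^ 3 * d + 5 * b ^ 4) * x + 5 * b ^ 4.

Lemma div5_E5 (b x e : C) : e ^ 2 = 1 - e ->
  5 * div5 (E5 b) x = - x * (x + b) * quintic e x b 1 * quintic (-1 - e) x b 1.
Proof.
  intros He. unfold div5, div3, div2_sq, div2_sq_half_deriv, E5, quintic. cbn [a1 a2 a3 a4 a6].
  ring [He].
Qed.

(** x = [x_param w (t / s)] cleared of denominators, for e = w + w^4; note 1 - e = e^2. *)
Definition x_equation (e x t s : C) : C :=
  5 * x * ((t ^ 2 + t * s + (1 - e) * s ^ 2) * s ^ 2) - (e - 2) * quartic_num t s.

(** The left side is the product of the equations of x at the five parameters over b. Comparing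
    coefficients of x^5 explains the constant: the five denominators multiply to (175 - 275 e) times
    the fourth power of [quartic_den]. The roots of unity enter only through quadratic relations of
    p and r over Q(e). *)
Lemma quintic_factor (p r e x t : C) :
  e ^ 2 = 1 - e -> p ^ 2 = - p - e - 2 -> r ^ 2 = - r + e - 1 ->
  x_equation e x t 1 *
    (x_equation e x (p * t + 1) (t + 1 + p) * x_equation e x (- (1 + p) * t + 1) (t - p)) *
    (x_equation e x (r * t + 1) (t + 1 + r) * x_equation e x (- (1 + r) * t + 1) (t - r)) =
  625 * (175 - 275 * e) * quintic e x (quartic_num t 1 * t) (quartic_den t 1).
Proof.
  intros He Hp Hr. unfold x_equation, quintic, quartic_num, quartic_den. ring [He Hp Hr].
Qed.

Lemma cyclotomic5_sum (w : C) : cyclotomic5 w -> (w + w ^ 4) ^ 2 = 1 - (w + w ^ 4).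
Proof. intros Hw. ring [(cyclotomic5_pow5 w Hw) (cyclotomic5_pow4 w Hw)]. Qed.

Definition moebius (p t : C) : C := (p * t + 1) / (t + 1 + p).

(* These are the deck transformations of the degree 5 map t |-> b. *)
Lemma good_param_moebius (b t w : C) : cyclotomic5 w -> good_param b t ->
  let p := w + w ^ 2 in t + 1 + p <> 0 /\ good_param b (moebius p t).
Proof.
  intros Hw (HD & Ht & Hb) p.
  pose proof (cyclotomic5_pow5 w Hw) as H5. pose proof (cyclotomic5_pow4 w Hw) as H4.
  set (e := w + w ^ 4).
  assert (He : e ^ 2 = 1 - e) by now apply cyclotomic5_sum.
  assert (Hp : p ^ 2 = - p - e - 2) by (unfold p, e; ring [H5 H4]).
  (* The value of [quartic_den x y * y] at t = 0, where x = 1 and y = 1 + p. It divides 25 in Z[w],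
     hence is nonzero. *)
  set (k := quartic_den 1 (1 + p) * (1 + p)).
  assert (Hk : k <> 0).
  { apply Cmult_nz_l with (3 + 6 * w - w ^ 2 + 7 * w ^ 3).
    replace (k * (3 + 6 * w - w ^ 2 + 7 * w ^ 3)) with (RtoC 25)
      by (unfold k, quartic_den, p; ring [H5 H4]).
    apply RtoC_neq_0. lra. }
  set (y := t + 1 + p). set (x := p * t + 1).
  assert (HkD : quartic_den x y * y = k * quartic_den t 1)
    by (unfold quartic_den, x, y, k, quartic_den; ring [He Hp]).
  assert (HkN : quartic_num x y * x = k * (quartic_num t 1 * t))
    by (unfold quartic_den, quartic_num, x, y, k, quartic_den; ring [He Hp]).
  assert (HyD : quartic_den x y * y <> 0) by (rewrite HkD; now apply Cmult_neq_0).
  pose proof (Cmult_nz_r _ _ HyD) as Hy. apply Cmult_nz_l in HyD.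
  split; [exact Hy|]. unfold moebius. fold x y.
  assert (HdD : quartic_den (x / y) 1 = quartic_den x y / y ^ 4)
    by (unfold quartic_den; field; exact Hy).
  assert (HdN : quartic_num (x / y) 1 = quartic_num x y / y ^ 4)
    by (unfold quartic_num; field; exact Hy).
  split; [|split].
  - rewrite HdD. intros H0. apply HyD.
    transitivity (y ^ 4 * (quartic_den x y / y ^ 4)); [field; exact Hy | rewrite H0; ring].
  (* The roots of 1 - s - s^2 are the fixed points of the transformation, which therefore preserves
     this quadratic up to a factor. *)
  - intros H0. apply Ht. apply Cmult_cancel_l with (RtoC 5); [apply C5_neq_0|].
    transitivity ((e - 2) * y ^ 2 * (1 - x / y - (x / y) ^ 2)); [|rewrite H0; ring].
    transitivity ((e - 2) * (y ^ 2 - x * y - x ^ 2)); [|field; exact Hy].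
    unfold x, y. clear - He Hp. ring [He Hp].
  - rewrite HdD, HdN.
    transitivity (b * (quartic_den x y * y) / y ^ 5); [field; exact Hy|].
    rewrite HkD. transitivity (k * (b * quartic_den t 1) / y ^ 5); [field; exact Hy|].
    rewrite Hb. transitivity (k * (quartic_num t 1 * t) / y ^ 5); [field; exact Hy|].
    rewrite <- HkN. field. exact Hy.
Qed.

(** Up to the square of [quartic_den], 1 - 11 b - b^2 becomes the fifth power of 1 - s - s^2: the
    map s -> b is totally ramified at the two common fixed points of its deck transformations. *)
Lemma E5_elliptic (b s : C) : b <> 0 -> good_param b s -> is_elliptic (E5 b).
Proof.
  intros Hb (HD & Hs & Hbs). unfold is_elliptic.
  assert (H : discriminant (E5 b) = b ^ 5 * (1 - 11 * b - b ^ 2))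
    by (unfold discriminant, E5; cbn [a1 a2 a3 a4 a6]; ring).
  rewrite H. apply Cmult_neq_0; [now apply Cpow_nz|].
  apply Cmult_nz_r with (quartic_den s 1 ^ 2).
  replace (quartic_den s 1 ^ 2 * (1 - 11 * b - b ^ 2)) with
    (quartic_den s 1 ^ 2 - 11 * (b * quartic_den s 1) * quartic_den s 1
     - (b * quartic_den s 1) ^ 2) by ring.
  rewrite Hbs.
  replace (quartic_den s 1 ^ 2 - 11 * (quartic_num s 1 * s) * quartic_den s 1
    - (quartic_num s 1 * s) ^ 2) with ((1 - s - s ^ 2) ^ 5)
    by (unfold quartic_den, quartic_num; ring).
  now apply Cpow_nz.
Qed.

(** * The subgroup generated by (0,0) *)

Lemma add_pt_origin (b : C) : b <> 0 ->
  add_pt (E5 b) (Affine 0 0) (Affine 0 0) = Affine (- b) (b ^ 2) /\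
  add_pt (E5 b) (Affine 0 0) (Affine (- b) (b ^ 2)) = Affine (- b) 0 /\
  add_pt (E5 b) (Affine 0 0) (Affine (- b) 0) = Affine 0 (- b) /\
  add_pt (E5 b) (Affine 0 0) (Affine 0 (- b)) = Infinity.
Proof.
  intros Hb.
  assert (Hnb : RtoC 0 <> - b)
    by (intros H; apply Hb; replace b with (- - b) by ring; rewrite <- H; ring).
  split; [|split; [|split]].
  - rewrite add_pt_tangent by (cbn; intros H; apply Hb; rewrite <- H; ring).
    unfold chord_pt, tangent, div2, opp_pt, E5. cbn [a1 a2 a3 a4 a6].
    replace (2 * 0 + (1 + b) * 0 + b) with b by ring.
    f_equal; field; exact Hb.
  - rewrite add_pt_chord by exact Hnb.
    unfold chord_pt, opp_pt, E5. cbn [a1 a2 a3 a4 a6].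
    replace (- b - 0) with (- b) by ring.
    replace ((b ^ 2 - 0) / - b) with (- b) by (field; exact Hb).
    f_equal; ring.
  - rewrite add_pt_chord by exact Hnb.
    unfold chord_pt, opp_pt, E5. cbn [a1 a2 a3 a4 a6].
    replace (- b - 0) with (- b) by ring.
    replace ((0 - 0) / - b) with (RtoC 0) by (field; exact Hb).
    f_equal; ring.
  - apply add_pt_opp. cbn. ring.
Qed.

Lemma mul_pt_origin (b : C) (n : nat) : b <> 0 ->
  In (mul_pt (E5 b) n (Affine 0 0))
    (Infinity :: Affine 0 0 :: Affine (- b) (b ^ 2) :: Affine (- b) 0 :: Affine 0 (- b) :: nil).
Proof.
  intros Hb. destruct (add_pt_origin b Hb) as (H2 & H3 & H4 & H5).
  induction n as [|n IH]; [now left|]. rewrite mul_pt_S.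
  cbn [In] in IH. destruct IH as [<-|[<-|[<-|[<-|[<-|[]]]]]];
    rewrite ?H2, ?H3, ?H4, ?H5; cbn [In add_pt]; auto 6.
Qed.

Lemma generated_origin_x (b x y : C) : b <> 0 ->
  generated (E5 b) (Affine 0 0) (Affine x y) -> x = 0 \/ x = - b.
Proof.
  intros Hb [k Hk]. unfold zmul_pt in Hk.
  pose proof (mul_pt_origin b (Z.abs_nat k) Hb) as H. cbn [In] in H.
  destruct (k <? 0)%Z;
    (destruct H as [H|[H|[H|[H|[H|[]]]]]]; rewrite <- H in Hk; cbn [opp_pt] in Hk;
     try discriminate; injection Hk; auto).
Qed.

Lemma generated_origin (b x y : C) : b <> 0 ->
  on_curve (E5 b) (Affine x y) -> x = 0 \/ x = - b ->
  generated (E5 b) (Affine 0 0) (Affine x y).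
Proof.
  intros Hb Hc Hx. destruct (add_pt_origin b Hb) as (H2 & H3 & H4 & _).
  unfold on_curve, E5 in Hc. cbn [a1 a2 a3 a4 a6] in Hc. unfold generated.
  assert (Hmul : mul_pt (E5 b) 1 (Affine 0 0) = Affine 0 0 /\
    mul_pt (E5 b) 2 (Affine 0 0) = Affine (- b) (b ^ 2) /\
    mul_pt (E5 b) 3 (Affine 0 0) = Affine (- b) 0 /\
    mul_pt (E5 b) 4 (Affine 0 0) = Affine 0 (- b)).
  { rewrite !mul_pt_S. change (mul_pt (E5 b) 0 (Affine 0 0)) with Infinity.
    change (add_pt (E5 b) (Affine 0 0) Infinity) with (Affine 0 0).
    rewrite H2, H3, H4. auto. }
  destruct Hmul as (M1 & M2 & M3 & M4).
  destruct Hx as [-> | ->].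
  - assert (Hy : y * (y + b) = 0).
    { transitivity (y ^ 2 + (1 + b) * 0 * y + b * y); [ring | rewrite Hc; ring]. }
    apply Cmult_integral in Hy as [-> | Hy].
    + exists 1%Z. symmetry. exact M1.
    + exists 4%Z. replace y with (- b) by (replace y with (y + b - b) by ring; rewrite Hy; ring).
      symmetry. exact M4.
  - assert (Hy : y * (y - b ^ 2) = 0).
    { transitivity (y ^ 2 + (1 + b) * - b * y + b * y); [ring | rewrite Hc; ring]. }
    apply Cmult_integral in Hy as [-> | Hy].
    + exists 3%Z. symmetry. exact M3.
    + exists 2%Z. replace y with (b ^ 2)
        by (replace y with (y - b ^ 2 + b ^ 2) by ring; rewrite Hy; ring).
      symmetry. exact M2.
Qed.

(** * Linear fractional factors over Q(zeta_5) *)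

Lemma subfield_Qadjoin (z : C) : subfield (Qadjoin z).
Proof.
  split.
  - intros K HK _. now apply subfield_1.
  - intros x y Hx Hy K HK Hz. apply subfield_sub; [exact HK | now apply Hx | now apply Hy].
  - intros x y Hx Hy K HK Hz. apply subfield_mul; [exact HK | now apply Hx | now apply Hy].
  - intros x Hx H0 K HK Hz. apply subfield_inv; [exact HK | now apply Hx | exact H0].
Qed.

Lemma Qadjoin_gen (z : C) : Qadjoin z z.
Proof. intros K _ Hz. exact Hz. Qed.

Lemma subfield_0 (K : C -> Prop) : subfield K -> K 0.
Proof.
  intros HK. replace (RtoC 0) with (1 - 1) by ring.
  apply subfield_sub; auto; now apply subfield_1.
Qed.

Lemma subfield_opp (K : C -> Prop) (x : C) : subfield K -> K x -> K (- x).
Proof.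
  intros HK Hx. replace (- x) with (0 - x) by ring.
  apply subfield_sub; auto. now apply subfield_0.
Qed.

Lemma subfield_add (K : C -> Prop) (x y : C) : subfield K -> K x -> K y -> K (x + y).
Proof.
  intros HK Hx Hy. replace (x + y) with (x - - y) by ring.
  apply subfield_sub; auto. now apply subfield_opp.
Qed.

Lemma subfield_pow (K : C -> Prop) (x : C) (n : nat) : subfield K -> K x -> K (x ^ n).
Proof.
  intros HK Hx. induction n as [|n IH]; simpl; [now apply subfield_1|].
  now apply subfield_mul.
Qed.

Lemma subfield_div5 (K : C -> Prop) (x : C) : subfield K -> K x -> K (x / 5).
Proof.
  intros HK Hx. unfold Cdiv. apply subfield_mul; auto. apply subfield_inv; auto using C5_neq_0.
  replace (RtoC 5) with (1 + 1 + 1 + 1 + 1) by ring.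
  repeat (apply subfield_add; auto); now apply subfield_1.
Qed.

Ltac in_subfield K := repeat
  (match goal with |- K _ => idtac | |- subfield K => idtac end;
   first [ assumption | now apply (subfield_1 K) | now apply (subfield_0 K)
     | apply (subfield_div5 K) | apply (subfield_add K) | apply (subfield_sub K)
     | apply (subfield_opp K) | apply (subfield_pow K) | apply (subfield_mul K) ]).

(** The expression c (T - r)/(T - d), pairing a zero with a pole; [lf_sub] takes the zeros that are
    left over. *)
Definition lf_quot (c r d : C) : linfrac := LinFrac c (- (c * r)) 1 (- d).

Definition lf_sub (r : C) : linfrac := LinFrac 1 (- r) 0 1.

(** The product of the coefficient matrices, so that determinants multiply and evaluation is
    composition. *)
Definition lf_comp (f g : linfrac) : linfrac :=
  LinFrac (lf_a f * lf_a g + lf_b f * lf_c g) (lf_a f * lf_b g + lf_b f * lf_d g)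
          (lf_c f * lf_a g + lf_d f * lf_c g) (lf_c f * lf_b g + lf_d f * lf_d g).

Lemma lf_quot_over (K : C -> Prop) (c r d : C) : subfield K ->
  K c -> K r -> K d -> c <> 0 -> r - d <> 0 -> linfrac_over K (lf_quot c r d).
Proof.
  intros HK Hc Hr Hd Hc0 Hrd. unfold linfrac_over, lf_quot. cbn [lf_a lf_b lf_c lf_d].
  repeat split; in_subfield K.
  replace (c * - d - - (c * r) * 1) with (c * (r - d)) by ring. now apply Cmult_neq_0.
Qed.

Lemma lf_sub_over (K : C -> Prop) (r : C) : subfield K -> K r -> linfrac_over K (lf_sub r).
Proof.
  intros HK Hr. unfold linfrac_over, lf_sub. cbn [lf_a lf_b lf_c lf_d].
  repeat split; in_subfield K.
  replace (1 * 1 - - r * 0) with (RtoC 1) by ring. apply C1_nz.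
Qed.

Lemma lf_comp_over (K : C -> Prop) (f g : linfrac) : subfield K ->
  linfrac_over K f -> linfrac_over K g -> linfrac_over K (lf_comp f g).
Proof.
  intros HK (Fa & Fb & Fc & Fd & F) (Ga & Gb & Gc & Gd & G).
  unfold linfrac_over, lf_comp. cbn [lf_a lf_b lf_c lf_d].
  repeat split; in_subfield K.
  apply (Cmult_neq_0 _ _ F) in G. intros H. apply G. rewrite <- H. ring.
Qed.

Lemma linfrac_prod_comp (L : list linfrac) (g : linfrac) (t v : C) :
  lf_c g * t + lf_d g <> 0 -> linfrac_prod L (linfrac_eval t g) v ->
  linfrac_prod (map (fun f => lf_comp f g) L) t v.
Proof.
  intros Hg [HF ->].
  assert (Hden : forall f, lf_c (lf_comp f g) * t + lf_d (lf_comp f g)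
    = (lf_c f * linfrac_eval t g + lf_d f) * (lf_c g * t + lf_d g))
    by (intros f; unfold linfrac_eval, lf_comp; cbn [lf_a lf_b lf_c lf_d]; field; exact Hg).
  split.
  - apply Forall_map. eapply Forall_impl; [|exact HF]. intros f Hf.
    rewrite Hden. now apply Cmult_neq_0.
  - induction HF as [|f L Hf HF IH]; [reflexivity|].
    cbn [map fold_right]. rewrite <- IH. f_equal.
    unfold linfrac_eval at 3. rewrite Hden. unfold linfrac_eval at 1.
    set (s := linfrac_eval t g) in *.
    replace (lf_a (lf_comp f g) * t + lf_b (lf_comp f g))
      with ((lf_a f * s + lf_b f) * (lf_c g * t + lf_d g)); [field; split; assumption|].
    unfold s, linfrac_eval, lf_comp. cbn [lf_a lf_b lf_c lf_d]. field. exact Hg.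
Qed.

(** Zeros and poles are paired, here and in [y_factors], so that each difference r - d is some 1 -
    w^k, which is visibly nonzero. *)
Definition x_factors (w : C) : list linfrac :=
  lf_quot ((w + w ^ 4 - 2) / 5) (1 + w) (w + w ^ 3) :: lf_quot 1 (1 + w ^ 2) (w ^ 2 + w ^ 4) ::
  lf_sub (1 + w ^ 3) :: lf_sub (1 + w ^ 4) :: nil.

Definition y_factors (w : C) : list linfrac :=
  lf_quot ((1 - w + w ^ 2 - w ^ 3) / 5) (1 + w) (w + w ^ 3) ::
  lf_quot 1 (1 + w ^ 2) (w ^ 2 + w ^ 4) :: lf_quot 1 (1 + w ^ 4) (w ^ 2 + w ^ 4) ::
  lf_quot 1 (1 + w) (w + w ^ 2) ::
  lf_sub (1 + w ^ 2) :: lf_sub (1 + w ^ 3) :: lf_sub (1 + w ^ 4) :: nil.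

Lemma y_param_num_neq_0 (w : C) : cyclotomic5 w -> (1 - w + w ^ 2 - w ^ 3) / 5 <> 0.
Proof.
  intros Hw H0. pose proof C5_neq_0 as H5n.
  assert (H1 : 1 - w + w ^ 2 - w ^ 3 = 0).
  { transitivity (5 * ((1 - w + w ^ 2 - w ^ 3) / 5)); [field; exact H5n | rewrite H0; ring]. }
  apply H5n. transitivity ((1 - w + w ^ 2 - w ^ 3) * (2 - w - 4 * w ^ 2 - 2 * w ^ 3));
    [ring [(cyclotomic5_pow5 w Hw) (cyclotomic5_pow4 w Hw)] | rewrite H1; ring].
Qed.

Lemma factors_over (K : C -> Prop) (w : C) : subfield K -> K w -> cyclotomic5 w ->
  List.Forall (linfrac_over K) (x_factors w) /\ List.Forall (linfrac_over K) (y_factors w).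
Proof.
  intros HK Hw Hc.
  assert (Hk : forall k, (k = 2 \/ k = 3 \/ k = 4)%nat -> 1 - w ^ k <> 0)
    by (intros k Hk; apply cyclotomic5_neq_1; now apply cyclotomic5_pow).
  assert (K2 : K 2) by (replace (RtoC 2) with (1 + 1) by ring; in_subfield K).
  pose proof (x_param_num_neq_0 w Hc). pose proof (y_param_num_neq_0 w Hc).
  pose proof (Hk 2%nat ltac:(auto)) as N2. pose proof (Hk 3%nat ltac:(auto)) as N3.
  pose proof (Hk 4%nat ltac:(auto)) as N4. clear Hk.
  split; repeat (apply Forall_cons || apply Forall_nil);
    (apply lf_quot_over || apply lf_sub_over); auto using C1_nz; try (in_subfield K; fail);
    intros H1; first [apply N2; rewrite <- H1; ring | apply N3; rewrite <- H1; ring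
      | apply N4; rewrite <- H1; ring].
Qed.

Lemma x_factors_prod (b s w : C) : cyclotomic5 w -> b <> 0 -> good_param b s ->
  linfrac_prod (x_factors w) s (x_param w s).
Proof.
  intros Hw Hb Hs.
  destruct (good_param_factors b s w Hw Hb Hs) as (_ & _ & H1 & H2 & _).
  pose proof C5_neq_0 as H5n.
  assert (D1 : 1 * s + - (w + w ^ 3) <> 0) by (intros H; apply H1; rewrite <- H; ring).
  assert (D2 : 1 * s + - (w ^ 2 + w ^ 4) <> 0) by (intros H; apply H2; rewrite <- H; ring).
  assert (D3 : 0 * s + 1 <> 0) by (intros H; apply C1_nz; rewrite <- H; ring).
  split.
  - unfold x_factors, lf_quot, lf_sub. repeat (apply List.Forall_cons; [assumption|]); apply List.Forall_nil.
  - rewrite Cmult_1_l in D1, D2.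
    unfold x_factors, x_param, linfrac_eval, lf_quot, lf_sub.
    cbn [map fold_right lf_a lf_b lf_c lf_d]. field. repeat split; auto.
Qed.

Lemma y_factors_prod (b s w : C) : cyclotomic5 w -> b <> 0 -> good_param b s ->
  linfrac_prod (y_factors w) s (y_param w s).
Proof.
  intros Hw Hb Hs.
  destruct (good_param_factors b s w Hw Hb Hs) as (_ & _ & H1 & H2 & H3 & _).
  pose proof C5_neq_0 as H5n.
  assert (D1 : 1 * s + - (w + w ^ 3) <> 0) by (intros H; apply H1; rewrite <- H; ring).
  assert (D2 : 1 * s + - (w ^ 2 + w ^ 4) <> 0) by (intros H; apply H2; rewrite <- H; ring).
  assert (D4 : 1 * s + - (w + w ^ 2) <> 0) by (intros H; apply H3; rewrite <- H; ring).
  assert (D3 : 0 * s + 1 <> 0) by (intros H; apply C1_nz; rewrite <- H; ring).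
  split.
  - unfold y_factors, lf_quot, lf_sub. repeat (apply List.Forall_cons; [assumption|]); apply List.Forall_nil.
  - rewrite Cmult_1_l in D1, D2, D4.
    unfold y_factors, y_param, linfrac_eval, lf_quot, lf_sub.
    cbn [map fold_right lf_a lf_b lf_c lf_d]. field. repeat split; auto.
Qed.

Lemma moebius_over (K : C -> Prop) (w : C) : subfield K -> K w -> cyclotomic5 w ->
  linfrac_over K (LinFrac (w + w ^ 2) 1 1 (1 + (w + w ^ 2))).
Proof.
  intros HK Hw Hc. unfold linfrac_over. cbn [lf_a lf_b lf_c lf_d].
  repeat split; try (in_subfield K; fail).
  intros H. apply C5_neq_0.
  (* With e = w + w^4 the determinant is -e - 3, and (-e - 3)(e - 2) = 5. *)
  transitivity (((w + w ^ 2) * (1 + (w + w ^ 2)) - 1 * 1) * (w + w ^ 4 - 2)).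
  - ring [(cyclotomic5_pow5 w Hc) (cyclotomic5_pow4 w Hc)].
  - rewrite H. ring.
Qed.

(** * The coordinates of all points outside the subgroup *)

Definition roots5 (z : C) : list C := z :: z ^ 2 :: z ^ 3 :: z ^ 4 :: nil.

Lemma roots5_cyclotomic5 (z w : C) : cyclotomic5 z -> In w (roots5 z) -> cyclotomic5 w.
Proof.
  intros Hz [<-|[<-|[<-|[<-|[]]]]]; [exact Hz|..]; apply cyclotomic5_pow; auto.
Qed.

Lemma roots5_pow (z w : C) (k : nat) : cyclotomic5 z -> In w (roots5 z) ->
  (k = 1 \/ k = 2 \/ k = 3 \/ k = 4)%nat -> In (w ^ k) (roots5 z).
Proof.
  intros Hz Hw Hk. pose proof (cyclotomic5_pow5 z Hz) as H5.
  assert (G : forall n, (n mod 5 <> 0)%nat -> In (z ^ n) (roots5 z)).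
  { intros n Hn. rewrite (Nat.div_mod_eq n 5), Cpow_add_r, Cpow_mult_r, H5, Cpow_1_l, Cmult_1_l.
    pose proof (Nat.mod_upper_bound n 5 ltac:(lia)).
    destruct (n mod 5)%nat as [|[|[|[|[|m]]]]]; [lia|..|lia];
      rewrite ?Cpow_1_r; cbn [In roots5]; auto. }
  destruct Hw as [<-|[<-|[<-|[<-|[]]]]]; rewrite <- ?Cpow_mult_r; apply G;
    destruct Hk as [-> |[-> |[-> | ->]]]; cbn; lia.
Qed.

Lemma roots5_field (z w : C) : In w (roots5 z) -> Qadjoin z w.
Proof.
  pose proof (subfield_Qadjoin z). pose proof (Qadjoin_gen z).
  intros [<-|[<-|[<-|[<-|[]]]]]; [assumption|..]; now apply subfield_pow.
Qed.

(** Twenty pairs, as many as E[5] has points outside the subgroup: four roots w, for the choice of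
    quintic and of sign, times five parameters over b. *)
Definition point_factors (z : C) : list (list linfrac * list linfrac) :=
  flat_map (fun w => (x_factors w, y_factors w) ::
    map (fun v => let g := LinFrac (v + v ^ 2) 1 1 (1 + (v + v ^ 2)) in
      (map (fun f => lf_comp f g) (x_factors w), map (fun f => lf_comp f g) (y_factors w)))
    (roots5 z)) (roots5 z).

Lemma point_factors_over (z : C) : cyclotomic5 z ->
  List.Forall (fun L => List.Forall (linfrac_over (Qadjoin z)) (fst L) /\
                   List.Forall (linfrac_over (Qadjoin z)) (snd L)) (point_factors z).
Proof.
  intros Hz. apply Forall_forall. intros L HL. pose proof (subfield_Qadjoin z) as HK.
  apply in_flat_map in HL as [w [Hw HL]].
  destruct (factors_over (Qadjoin z) w HK (roots5_field z w Hw) (roots5_cyclotomic5 z w Hz Hw))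
    as [Fx Fy].
  destruct HL as [<-|HL]; [now split|].
  apply in_map_iff in HL as [v [<- Hv]].
  pose proof (moebius_over (Qadjoin z) v HK (roots5_field z v Hv) (roots5_cyclotomic5 z v Hz Hv)).
  split; cbn [fst snd]; apply Forall_map; (eapply Forall_impl; [|eassumption]);
    intros f Hf; now apply lf_comp_over.
Qed.

Lemma point_factors_prod (z b t w s : C) : cyclotomic5 z -> b <> 0 -> good_param b t ->
  In w (roots5 z) ->
  s = t \/ (exists v, In v (roots5 z) /\ s = moebius (v + v ^ 2) t) ->
  exists LX LZ, In (LX, LZ) (point_factors z) /\
    linfrac_prod LX t (x_param w s) /\ linfrac_prod LZ t (y_param w s).
Proof.
  intros Hz Hb Ht Hw Hs. pose proof (roots5_cyclotomic5 z w Hz Hw) as Hwc.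
  destruct Hs as [-> | [v [Hv ->]]].
  - exists (x_factors w), (y_factors w). split; [|split].
    + apply in_flat_map. exists w. split; [exact Hw | now left].
    + now apply (x_factors_prod b).
    + now apply (y_factors_prod b).
  - pose proof (roots5_cyclotomic5 z v Hz Hv) as Hvc.
    destruct (good_param_moebius b t v Hvc Ht) as [Hden Hg].
    set (g := LinFrac (v + v ^ 2) 1 1 (1 + (v + v ^ 2))).
    assert (Hgd : lf_c g * t + lf_d g <> 0)
      by (cbn; intros H; apply Hden; rewrite <- H; ring).
    assert (Hge : linfrac_eval t g = moebius (v + v ^ 2) t).
    { unfold linfrac_eval, moebius, g. cbn [lf_a lf_b lf_c lf_d]. f_equal. ring. }
    exists (map (fun f => lf_comp f g) (x_factors w)), (map (fun f => lf_comp f g) (y_factors w)).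
    split; [|split].
    + apply in_flat_map. exists w. split; [exact Hw|]. right.
      apply in_map_iff. exists v. now split.
    + apply linfrac_prod_comp; [exact Hgd|]. rewrite Hge. now apply (x_factors_prod b).
    + apply linfrac_prod_comp; [exact Hgd|]. rewrite Hge. now apply (y_factors_prod b).
Qed.

Lemma x_equation_solve (b w x s y : C) : cyclotomic5 w -> b <> 0 -> y <> 0 ->
  good_param b (s / y) -> x_equation (w + w ^ 4) x s y = 0 -> x = x_param w (s / y).
Proof.
  intros Hw Hb Hy Hs H. unfold x_equation in H.
  destruct (good_param_factors b (s / y) w Hw Hb Hs) as (_ & _ & K1 & K2 & _).
  pose proof C5_neq_0 as H5n.
  set (r := s / y) in *. assert (Hsr : s = r * y) by (unfold r; field; exact Hy).
  unfold x_param. rewrite <- (quartic_num_factor w r Hw).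
  apply Cmult_cancel_l with (5 * ((r - w - w ^ 3) * (r - w ^ 2 - w ^ 4)));
    [repeat apply Cmult_neq_0; auto|].
  transitivity ((w + w ^ 4 - 2) * quartic_num r 1); [|field; auto].
  apply Cmult_cancel_l with (y ^ 4); [now apply Cpow_nz|].
  replace (y ^ 4 * ((w + w ^ 4 - 2) * quartic_num r 1)) with
    (5 * x * ((s ^ 2 + s * y + (1 - (w + w ^ 4)) * y ^ 2) * y ^ 2)
     - (5 * x * ((s ^ 2 + s * y + (1 - (w + w ^ 4)) * y ^ 2) * y ^ 2)
        - (w + w ^ 4 - 2) * quartic_num s y))
    by (rewrite Hsr; unfold quartic_num; ring).
  rewrite H, Hsr. clear - Hw. ring [(cyclotomic5_pow5 w Hw) (cyclotomic5_pow4 w Hw)].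
Qed.

Lemma x_param_equation (b w s : C) : cyclotomic5 w -> b <> 0 -> good_param b s ->
  x_equation (w + w ^ 4) (x_param w s) s 1 = 0.
Proof.
  intros Hw Hb Hs. unfold x_equation.
  destruct (good_param_factors b s w Hw Hb Hs) as (_ & _ & K1 & K2 & _).
  pose proof C5_neq_0 as H5n.
  unfold x_param. rewrite <- (quartic_num_factor w s Hw).
  replace (s ^ 2 + s * 1 + (1 - (w + w ^ 4)) * 1 ^ 2) with ((s - w - w ^ 3) * (s - w ^ 2 - w ^ 4))
    by (clear - Hw; ring [(cyclotomic5_pow5 w Hw) (cyclotomic5_pow4 w Hw)]).
  field. auto.
Qed.

Lemma quintic_scale (b t e x : C) : good_param b t ->
  quintic e x (quartic_num t 1 * t) (quartic_den t 1) = quartic_den t 1 ^ 4 * quintic e x b 1.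
Proof.
  intros (_ & _ & <-). unfold quintic. ring.
Qed.

Lemma quintic_product (b w t x : C) : cyclotomic5 w -> good_param b t ->
  let e := w + w ^ 4 in let p := w + w ^ 2 in let r := w + w ^ 3 in
  x_equation e x t 1 *
    (x_equation e x (p * t + 1) (t + 1 + p) * x_equation e x (- (1 + p) * t + 1) (t - p)) *
    (x_equation e x (r * t + 1) (t + 1 + r) * x_equation e x (- (1 + r) * t + 1) (t - r)) =
  625 * (175 - 275 * e) * quartic_den t 1 ^ 4 * quintic e x b 1.
Proof.
  intros Hw Ht e p r.
  pose proof (cyclotomic5_pow5 w Hw) as H5. pose proof (cyclotomic5_pow4 w Hw) as H4.
  rewrite quintic_factor.
  - rewrite (quintic_scale b) by exact Ht. ring.
  - now apply cyclotomic5_sum.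
  - unfold p, e. ring [H5 H4].
  - unfold r, e. ring [H5 H4].
Qed.

Lemma quintic_x_param (b w t : C) : cyclotomic5 w -> b <> 0 -> good_param b t ->
  quintic (w + w ^ 4) (x_param w t) b 1 = 0.
Proof.
  intros Hw Hb Ht. pose proof (quintic_product b w t (x_param w t) Hw Ht) as H.
  cbv zeta in H. rewrite (x_param_equation b w t Hw Hb Ht), !Cmult_0_l in H.
  symmetry in H. apply Cmult_integral in H as [H|H]; [exfalso|exact H].
  apply Cmult_integral in H as [H|H]; [|now apply (Cpow_nz (quartic_den t 1) 4) in H; [|apply Ht]].
  apply (RtoC_neq_0 (625 * 3125)); [lra|].
  (* 450 + 275 e is the conjugate of 175 - 275 e under e -> -1 - e; their product is 3125. *)
  transitivity (625 * (175 - 275 * (w + w ^ 4)) * (450 + 275 * (w + w ^ 4))); [|rewrite H; ring].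
  rewrite RtoC_mult. ring [(cyclotomic5_pow5 w Hw) (cyclotomic5_pow4 w Hw)].
Qed.

Lemma quintic_roots (b w t x : C) : cyclotomic5 w -> b <> 0 -> good_param b t ->
  quintic (w + w ^ 4) x b 1 = 0 ->
  exists s, good_param b s /\ x = x_param w s /\
    (s = t \/ exists v, In v (roots5 w) /\ s = moebius (v + v ^ 2) t).
Proof.
  intros Hw Hb Ht H0. pose proof (quintic_product b w t x Hw Ht) as H.
  cbv zeta in H. rewrite H0, Cmult_0_r in H.
  pose proof (cyclotomic5_pow5 w Hw) as H5. pose proof (cyclotomic5_pow4 w Hw) as H4.
  assert (G : forall v u y, In v (roots5 w) -> u = (v + v ^ 2) * t + 1 -> y = t + 1 + (v + v ^ 2) ->
    x_equation (w + w ^ 4) x u y = 0 ->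
    exists s, good_param b s /\ x = x_param w s /\
    (s = t \/ exists v, In v (roots5 w) /\ s = moebius (v + v ^ 2) t)).
  { intros v u y Hv -> -> He.
    destruct (good_param_moebius b t v (roots5_cyclotomic5 w v Hw Hv) Ht) as [Hy Hg].
    exists (moebius (v + v ^ 2) t). split; [exact Hg|]. split; [|right; exists v; split; [exact Hv | reflexivity]].
    exact (x_equation_solve b w x _ _ Hw Hb Hy Hg He). }
  assert (R1 : In w (roots5 w)) by (left; reflexivity).
  assert (R2 : In (w ^ 2) (roots5 w)) by (right; left; reflexivity).
  assert (R3 : In (w ^ 3) (roots5 w)) by (right; right; left; reflexivity).
  assert (R4 : In (w ^ 4) (roots5 w)) by (right; right; right; left; reflexivity).
  (* For v = w, w^4, w^3, w^2 the value v + v^2 is p, -1 - p, r, -1 - r, so each factor belongs to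
     the identity or to one deck transformation. *)
  apply Cmult_integral in H as [H|H]; [apply Cmult_integral in H as [H|H]|].
  - exists t. split; [exact Ht|]. split; [|now left].
    pose proof (x_equation_solve b w x t 1 Hw Hb C1_nz) as HS.
    replace (t / 1) with t in HS by (field; apply C1_nz). now apply HS.
  - apply Cmult_integral in H as [H|H].
    + now apply (G w) in H.
    + apply (G (w ^ 4)) in H; [exact H | exact R4 | ring [H5 H4] | ring [H5 H4]].
  - apply Cmult_integral in H as [H|H].
    + apply (G (w ^ 3)) in H; [exact H | exact R3 | ring [H5 H4] | ring [H5 H4]].
    + apply (G (w ^ 2)) in H; [exact H | exact R2 | ring [H5 H4] | ring [H5 H4]].
Qed.

Lemma on_curve_y_param (b w s y : C) : cyclotomic5 w -> b <> 0 -> good_param b s ->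
  on_curve (E5 b) (Affine (x_param w s) y) <-> y = y_param w s \/ y = y_param (w ^ 4) s.
Proof.
  intros Hw Hb Hs.
  pose proof (y_param_sum b s w Hw Hb Hs) as HS. pose proof (y_param_prod b s w Hw Hb Hs) as HP.
  set (x := x_param w s) in *. set (y1 := y_param w s) in *. set (y2 := y_param (w ^ 4) s) in *.
  unfold on_curve, E5. cbn [a1 a2 a3 a4 a6].
  assert (He : y ^ 2 + (1 + b) * x * y + b * y - (x ^ 3 + b * x ^ 2 + 0 * x + 0)
    = (y - y1) * (y - y2)).
  { transitivity (y ^ 2 - (y1 + y2) * y + y1 * y2); [rewrite HS, HP|]; ring. }
  split.
  - intros H. rewrite H in He.
    destruct (Cmult_integral (y - y1) (y - y2)) as [H1|H1]; [rewrite <- He; ring | left | right].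
    + replace y with (y - y1 + y1) by ring. rewrite H1. ring.
    + replace y with (y - y2 + y2) by ring. rewrite H1. ring.
  - intros H. assert (H0 : (y - y1) * (y - y2) = 0) by (destruct H as [-> | ->]; ring).
    rewrite H0 in He.
    replace (y ^ 2 + (1 + b) * x * y + b * y) with
      (y ^ 2 + (1 + b) * x * y + b * y - (x ^ 3 + b * x ^ 2 + 0 * x + 0)
       + (x ^ 3 + b * x ^ 2 + 0 * x + 0)) by ring. rewrite He. ring.
Qed.

Lemma sqrt_5 : RtoC (sqrt 5) = 2 * eps + 1.
Proof. unfold eps. field. Qed.

Lemma eps_sq : eps ^ 2 = 1 - eps.
Proof.
  assert (H : RtoC (sqrt 5) * RtoC (sqrt 5) = 5).
  { rewrite <- RtoC_mult, sqrt_sqrt by lra. reflexivity. }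
  unfold eps. apply Cmult_cancel_l with (RtoC 4); [apply RtoC_neq_0; lra|].
  transitivity (1 - 2 * RtoC (sqrt 5) + RtoC (sqrt 5) * RtoC (sqrt 5));
    [field|].
  rewrite H. field.
Qed.

(** z + z^4 and z^2 + z^8 are the two roots of X^2 + X - 1; which one is eps depends on the choice
    of z. *)
Lemma eps_root (z : C) : cyclotomic5 z ->
  exists w, In w (roots5 z) /\ w + w ^ 4 = eps.
Proof.
  intros Hz. pose proof (cyclotomic5_pow5 z Hz) as H5. pose proof (cyclotomic5_pow4 z Hz) as H4.
  assert (H : (z + z ^ 4 - eps) * (z ^ 2 + (z ^ 2) ^ 4 - eps) = 0)
    by (transitivity (eps ^ 2 - (1 - eps)); [ring [H5 H4] | rewrite eps_sq; ring]).
  apply Cmult_integral in H as [H|H].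
  - exists z. split; [now left|]. replace (z + z ^ 4) with (z + z ^ 4 - eps + eps) by ring.
    rewrite H. ring.
  - exists (z ^ 2). split; [right; now left|].
    replace (z ^ 2 + (z ^ 2) ^ 4) with (z ^ 2 + (z ^ 2) ^ 4 - eps + eps) by ring.
    rewrite H. ring.
Qed.

Lemma X_coord_param (b w t : C) : cyclotomic5 w -> b <> 0 -> good_param b t -> w + w ^ 4 = eps ->
  X_den t <> 0 /\ X_coord t = x_param w t.
Proof.
  intros Hw Hb Ht Hwe.
  destruct (good_param_factors b t w Hw Hb Ht) as (_ & _ & K1 & K2 & _).
  pose proof C5_neq_0 as H5n.
  assert (HX : X_den t = (t - w - w ^ 3) * (t - w ^ 2 - w ^ 4)).
  { unfold X_den. rewrite eps_sq, <- Hwe. clear - Hw.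
    ring [(cyclotomic5_pow5 w Hw) (cyclotomic5_pow4 w Hw)]. }
  split; [rewrite HX; now apply Cmult_neq_0|].
  unfold X_coord, x_param. rewrite <- (quartic_num_factor w t Hw), <- HX, Hwe, sqrt_5.
  assert (Hs : (2 * eps + 1) * (2 * eps + 1) = 5)
    by (transitivity (4 * eps ^ 2 + 4 * eps + 1); [ring | rewrite eps_sq; ring]).
  assert (Hs0 : 2 * eps + 1 <> 0) by (intros H; apply H5n; rewrite <- Hs, H; ring).
  f_equal; [|unfold quartic_num; f_equal; ring].
  apply Cmult_cancel_l with (5 * (2 * eps + 1)); [now apply Cmult_neq_0|].
  transitivity (- (5 * eps)); [field; exact Hs0|].
  transitivity ((eps - 2) * (2 * eps + 1)); [|field; exact H5n].
  transitivity (2 * eps ^ 2 - 3 * eps - 2); [rewrite eps_sq|]; ring.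
Qed.

(** Outside the subgroup x (x + b) is nonzero, so x is a root of one of the two quintics, which
    belong to w = z and w = z^2. The two ordinates over x belong to w and w^4. *)
Lemma torsion_points (z b t : C) (Q : point) : cyclotomic5 z -> b <> 0 -> good_param b t ->
  torsion (E5 b) 5 Q -> ~ generated (E5 b) (Affine 0 0) Q ->
  exists (LX LZ : list linfrac) (x y : C),
    In (LX, LZ) (point_factors z) /\ Q = Affine x y /\
    linfrac_prod LX t x /\ linfrac_prod LZ t y.
Proof.
  intros Hz Hb Ht [Hc H5] Hg.
  destruct Q as [|x y]; [exfalso; apply Hg; exists 0%Z; reflexivity|].
  assert (Hx : x <> 0 /\ x + b <> 0).
  { split; intros H; apply Hg, generated_origin; auto. right.
    replace x with (x + b - b) by ring. rewrite H. ring. }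
  pose proof (torsion5_div5 _ _ _ Hc H5) as Hd.
  pose proof (div5_E5 b x (z + z ^ 4) (cyclotomic5_sum z Hz)) as He.
  rewrite Hd, Cmult_0_r in He. symmetry in He.
  assert (Hw : exists w, In w (roots5 z) /\ quintic (w + w ^ 4) x b 1 = 0).
  { apply Cmult_integral in He as [He|He]; [apply Cmult_integral in He as [He|He]|].
    - exfalso. apply Cmult_integral in He as [He|He]; [apply (proj1 Hx) | now apply (proj2 Hx)].
      replace x with (- - x) by ring. rewrite He. ring.
    - exists z. split; [now left | exact He].
    - exists (z ^ 2). split; [right; now left|]. rewrite <- He. f_equal.
      ring [(cyclotomic5_pow5 z Hz) (cyclotomic5_pow4 z Hz)]. }
  destruct Hw as [w [Hw Hq]]. pose proof (roots5_cyclotomic5 z w Hz Hw) as Hwc.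
  destruct (quintic_roots b w t x Hwc Hb Ht Hq) as (s & Hs & -> & Hst).
  assert (Hst' : s = t \/ exists v, In v (roots5 z) /\ s = moebius (v + v ^ 2) t).
  { destruct Hst as [Hst|[v [Hv Hst]]]; [now left | right]. exists v. split; [|exact Hst].
    destruct Hv as [<-|[<-|[<-|[<-|[]]]]]; [exact Hw|..]; apply roots5_pow; auto. }
  apply (on_curve_y_param b w s y Hwc Hb Hs) in Hc as [-> | ->].
  - destruct (point_factors_prod z b t w s Hz Hb Ht Hw Hst') as (LX & LZ & HI & HX & HY).
    exists LX, LZ, (x_param w s), (y_param w s).
    split; [exact HI | split; [reflexivity | split; assumption]].
  - destruct (point_factors_prod z b t (w ^ 4) s Hz Hb Ht (roots5_pow z w 4 Hz Hw ltac:(auto)) Hst')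
      as (LX & LZ & HI & HX & HY).
    exists LX, LZ, (x_param w s), (y_param (w ^ 4) s). rewrite (x_param_conj w s Hwc) in HX.
    split; [exact HI | split; [reflexivity | split; assumption]].
Qed.

Theorem theorem1p1 (zeta : C) (hzeta : primitive_root 5 zeta) :
  exists (LY LY' : list linfrac) (LQ : list (list linfrac * list linfrac)),
    List.Forall (linfrac_over (Qadjoin zeta)) LY /\
    List.Forall (linfrac_over (Qadjoin zeta)) LY' /\
    List.Forall (fun L => List.Forall (linfrac_over (Qadjoin zeta)) (fst L) /\
                     List.Forall (linfrac_over (Qadjoin zeta)) (snd L)) LQ /\
    forall tau : C, (0 < Im tau)%R ->
      let E := E5 (rr tau ^ 5) in
      let t := rr (5 * tau) in
      is_elliptic E /\
      X_den t <> 0 /\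
      (exists Y Y' : C,
         let P := Affine (X_coord t) Y in
         on_curve E P /\ has_order E P 5 /\ ~ generated E (Affine 0 0) P /\
         opp_pt E P = Affine (X_coord t) Y' /\
         linfrac_prod LY t Y /\ linfrac_prod LY' t Y') /\
      (forall Q : point,
         torsion E 5 Q -> ~ generated E (Affine 0 0) Q ->
         exists (LX LZ : list linfrac) (x y : C),
           In (LX, LZ) LQ /\ Q = Affine x y /\
           linfrac_prod LX t x /\ linfrac_prod LZ t y).
Proof.
  pose proof (primitive_root_cyclotomic5 zeta hzeta) as Hz.
  destruct (eps_root zeta Hz) as [w [Hw Hwe]].
  pose proof (roots5_pow zeta w 4 Hz Hw ltac:(auto)) as Hw4.
  pose proof (roots5_cyclotomic5 _ _ Hz Hw) as Hwc.
  pose proof (roots5_cyclotomic5 _ _ Hz Hw4) as Hw4c.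
  pose proof (subfield_Qadjoin zeta) as HK.
  (* w and w^4 give the same abscissa and opposite points. *)
  exists (y_factors w), (y_factors (w ^ 4)), (point_factors zeta).
  split; [apply factors_over; auto; now apply roots5_field|].
  split; [apply factors_over; auto; now apply roots5_field|].
  split; [now apply point_factors_over|].
  intros tau Htau E t.
  destruct (rr_relation zeta tau Hz Htau) as (Hu & _ & Ht1 & HtD & Hrel).
  set (b := rr tau ^ 5) in *. fold t in Ht1, HtD, Hrel.
  assert (Hb : b <> 0) by now apply Cpow_nz.
  assert (Ht : good_param b t) by (split; [exact HtD | split; [exact Ht1 | exact Hrel]]).
  destruct (X_coord_param b w t Hwc Hb Ht Hwe) as [HXd HX].
  split; [now apply E5_elliptic with t|]. split; [exact HXd|].
  split; [|intros Q; now apply torsion_points].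
  exists (y_param w t), (y_param (w ^ 4) t). cbv zeta. rewrite HX.
  pose proof (y_param_sum b t w Hwc Hb Ht) as HS.
  assert (Hc : on_curve E (Affine (x_param w t) (y_param w t)))
    by (apply (on_curve_y_param b w t); auto).
  split; [exact Hc|]. split; [|split; [|split; [|split]]].
  - apply div5_order5; [exact Hc| |].
    (* A zero of [div2] would make the ordinates of P and -P coincide. *)
    + unfold div2, E, E5. cbn [a1 a3]. intros H.
      apply (y_param_distinct b t w Hwc Hb Ht).
      transitivity (y_param w t - (2 * y_param w t + (1 + b) * x_param w t + b)); [rewrite H; ring|].
      transitivity (- ((1 + b) * x_param w t + b) - y_param w t); [ring|]. rewrite <- HS. ring.
    + apply Cmult_cancel_l with (RtoC 5); [apply C5_neq_0|]. unfold E.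
      rewrite (div5_E5 b _ (w + w ^ 4)) by now apply cyclotomic5_sum.
      rewrite (quintic_x_param b w t) by auto. ring.
  - intros Hg. destruct (x_param_neq b t w Hwc Hb Ht) as [N1 N2].
    apply generated_origin_x in Hg as [Hg|Hg]; [contradiction| |exact Hb].
    apply N2. rewrite Hg. ring.
  - cbn [opp_pt]. f_equal. unfold E, E5. cbn [a1 a3].
    transitivity (- ((1 + b) * x_param w t + b) - y_param w t); [ring|]. rewrite <- HS. ring.
  - now apply (y_factors_prod b).
  - now apply (y_factors_prod b).
Qed.
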